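(* Let $1\le p\le\infty$, let $p'$ be the conjugate exponent of $p$, let $(V,V^+,\Vert\cdot\Vert)$ be a complete order smooth $p$-normed space, and let $W$ be a closed subspace of $V$. Then: (i) $(W,W^+,\Vert\cdot\Vert)$ is an order smooth $p$-normed space if and only if $(V^*/W^\perp,(V^*/W^\perp)^+,\Vert\cdot\Vert)$ is an order smooth $p'$-normed space satisfying $(OS.p'.2)$. (ii) $(V/W,(V/W)^+,\Vert\cdot\Vert)$ is an order smooth $p$-normed space if and only if $(W^\perp,W^{\perp+},\Vert\cdot\Vert)$ is an order smooth $p'$-normed space satisfying $(OS.p'.2)$.
   Context: A cone in a real vector space is a set $C$ with $\lambda x+y\in C$ for $x,y\in C$, $\lambda\ge 0$; it is proper if $C\cap(-C)=\{0\}$. For a cone $V^+$ in $V$, write $x\le y$ if $y-x\in V^+$; $V^+$ is generating if $V=V^+-V^+$. Conjugate exponents: $1/p+1/p'=1$, with $1'=\infty$, $\infty'=1$. Let $V$ be a real normed space with a cone $V^+$ that is proper, generating and norm closed. For $1\le p<\infty$ consider the conditions: $(O.p.1)$: $u\le v\le w$ implies $\Vert v\Vert\le(\Vert u\Vert^p+\Vert w\Vert^p)^{1/p}$; $(O.p.2)$: for every $v\in V$ and $\epsilon>0$ there are $v_1,v_2\in V^+$ with $v=v_1-v_2$ and $(\Vert v_1\Vert^p+\Vert v_2\Vert^p)^{1/p}<\Vert v\Vert+\epsilon$; $(OS.p.2)$: for every $v\in V$ there are $v_1,v_2\in V^+$ with $v=v_1-v_2$ and $(\Vert v_1\Vert^p+\Vert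 v_2\Vert^p)^{1/p}\le\Vert v\Vert$. For $p=\infty$, replace $(a^p+b^p)^{1/p}$ by $\max\{a,b\}$. $(V,V^+,\Vert\cdot\Vert)$ is an order smooth $p$-normed space if $V^+$ is proper, generating and closed and $(O.p.1)$ and $(O.p.2)$ hold. For an ordered normed space $V$, the dual cone on the Banach dual $V^*$ is $V^{*+}=\{f\in V^*: f(v)\ge0\ \forall v\in V^+\}$. For a closed subspace $W$: $W^+=W\cap V^+$; $W^\perp=\{f\in V^*: f|_W=0\}$ with $W^{\perp+}=W^\perp\cap V^{*+}$; $\varphi_W:V\to V/W$ and $\varphi_{W^\perp}:V^*\to V^*/W^\perp$ are the quotient maps, quotients carrying the quotient norm. The quotient cones are $(V/W)^+=\overline{\varphi_W(V^+)}^{\Vert\cdot\Vert}$ (norm closure) and $(V^*/W^\perp)^+=\overline{\varphi_{W^\perp}(V^{*+})}^{w^*}$, the weak$^*$ closure with respect to the identification of $V^*/W^\perp$ with $W^*$. *)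

(* Defs.v *)
From HB Require Import structures.
From mathcomp Require Import all_boot all_order all_algebra.
From mathcomp Require Import generic_quotient ring_quotient.
From mathcomp Require Import all_classical all_reals all_analysis.
From mathcomp Require Import ring.

Set Implicit Arguments.
Unset Strict Implicit.
Unset Printing Implicit Defensive.

Import Order.TTheory GRing.Theory Num.Theory.
Import numFieldNormedType.Exports.

Local Open Scope classical_set_scope.
Local Open Scope ring_scope.
Local Open Scope quotient_scope.

Section OrderSmooth.
Context {R : realType}.

(* Only used for p in [1, +oo]: the value at -oo is a placeholder. *)
Definition pcomb (p : \bar R) (a b : R) : R :=
  match p with
  | r%:E => (a `^ r + b `^ r) `^ r^-1
  | +oo%E => Num.max a b
  | -oo%E => 0
  end.

Context {V : normedModType R}.
Implicit Types (p : \bar R) (C : set V).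

Definition is_cone C : Prop :=
  forall (a : R) (x y : V), 0 <= a -> C x -> C y -> C (a *: x + y).

Definition proper_cone C : Prop := C `&` [set - x | x in C] = [set 0].

Definition generating_cone C : Prop :=
  forall v : V, exists v1 v2, [/\ C v1, C v2 & v = v1 - v2].

Definition cone_le C (x y : V) : Prop := C (y - x).

Definition Op1 p C : Prop :=
  forall u v w : V, cone_le C u v -> cone_le C v w ->
    `|v| <= pcomb p `|u| `|w|.

Definition Op2 p C : Prop :=
  forall (v : V) (e : R), 0 < e -> exists v1 v2,
    [/\ C v1, C v2, v = v1 - v2 & pcomb p `|v1| `|v2| < `|v| + e].

Definition OSp2 p C : Prop :=
  forall v : V, exists v1 v2,
    [/\ C v1, C v2, v = v1 - v2 & pcomb p `|v1| `|v2| <= `|v|].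

Definition order_smooth p C : Prop :=
  [/\ is_cone C, proper_cone C, generating_cone C & closed C] /\
  (Op1 p C /\ Op2 p C).

End OrderSmooth.

Record closedSubspace (R : realType) (V : normedModType R) := ClosedSubspace {
  csub_set :> set V ;
  csub_submod : submod_closed [pred x | x \in csub_set] ;
  csub_closed : closed csub_set }.

Definition csub_pred (R : realType) (V : normedModType R)
  (W : closedSubspace V) : {pred V} := [pred x | x \in csub_set W].

HB.instance Definition _ (R : realType) (V : normedModType R)
    (W : closedSubspace V) :=
  GRing.isSubmodClosed.Build R V (csub_pred W) (csub_submod W).

Lemma csub_predE (R : realType) (V : normedModType R) (W : closedSubspace V)
  (x : V) : x \in csub_pred W <-> csub_set W x.
Proof. by split=> [/set_mem|/mem_set]. Qed.

Record csubType (R : realType) (V : normedModType R) (W : closedSubspace V) :=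
  CSubType { csub_val : V ; _ : csub_val \in csub_pred W }.

Section Subspace.
Context {R : realType} {V : normedModType R} (W : closedSubspace V).

HB.instance Definition _ := [isSub for @csub_val R V W].
HB.instance Definition _ := [Choice of csubType W by <:].
HB.instance Definition _ := [SubChoice_isSubLmodule of csubType W by <:].

Definition csub_norm (x : csubType W) : R := `|val x|.

Lemma csub_normD (x y : csubType W) :
  csub_norm (x + y) <= csub_norm x + csub_norm y.
Proof. by rewrite /csub_norm raddfD ler_normD. Qed.

Lemma csub_normZ (a : R) (x : csubType W) :
  csub_norm (a *: x) = `|a| * csub_norm x.
Proof. by rewrite /csub_norm linearZ normrZ. Qed.

Lemma csub_norm0_eq0 (x : csubType W) : csub_norm x = 0 -> x = 0.
Proof.
by move=> /normr0_eq0 x0; apply: val_inj; rewrite x0 raddf0.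
Qed.

HB.instance Definition _ := Lmodule_isNormed.Build R (csubType W)
  csub_normD csub_normZ csub_norm0_eq0.

Lemma csub_normE (x : csubType W) : `|x| = `|val x|.
Proof. by []. Qed.

Lemma csub_val_continuous : continuous (val : csubType W -> V).
Proof.
move=> x; apply/(@cvgrPdist_lt _ _ _ (nbhs x)) => e e0.
near=> y; rewrite -raddfB -csub_normE.
by near: y; exact: cvgr_dist_lt.
Unshelve. all: by end_near. Qed.

Definition sub_cone (C : set V) : set (csubType W) := val @^-1` C.

End Subspace.

Definition quotSpace (R : realType) (V : normedModType R)
  (W : closedSubspace V) : Type := Quotient.quot (csub_pred W).

Section QuotientSpace.
Context {R : realType} {V : normedModType R} (W : closedSubspace V).
Local Notation Q := (quotSpace W).

HB.instance Definition _ := ZmodQuotient.copy Q (Quotient.quot (csub_pred W)).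

Definition quot_map (x : V) : Q := \pi_Q x.

Lemma quot_mapP (x y : V) : quot_map x = quot_map y <-> csub_set W (x - y).
Proof.
rewrite -csub_predE (Quotient.idealrBE _ x y).
by split=> [xy|/eqP//]; apply/eqP.
Qed.

Lemma quot_map_surj (q : Q) : exists x, quot_map x = q.
Proof. by exists (repr q); rewrite /quot_map reprK. Qed.

Lemma quot_mapD (x y : V) : quot_map (x + y) = quot_map x + quot_map y.
Proof. exact: raddfD. Qed.

Lemma quot_map0 : quot_map 0 = 0.
Proof. exact: raddf0. Qed.

Definition quot_scale (a : R) (q : Q) : Q := quot_map (a *: repr q).

Lemma quot_mapZ (a : R) (x : V) : quot_map (a *: x) = quot_scale a (quot_map x).
Proof.
apply/quot_mapP; rewrite -scalerBr -csub_predE rpredZ// csub_predE.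
apply/quot_mapP.
by rewrite /quot_map reprK.
Qed.

Lemma quot_scaleA (a b : R) (q : Q) :
  quot_scale a (quot_scale b q) = quot_scale (a * b) q.
Proof. by have [x <-] := quot_map_surj q; rewrite -!quot_mapZ scalerA. Qed.

Lemma quot_scale1 : left_id 1 quot_scale.
Proof.
by move=> q; have [x <-] := quot_map_surj q; rewrite -!quot_mapZ scale1r.
Qed.

Lemma quot_scaleDr : right_distributive quot_scale +%R.
Proof.
move=> a q r; have [x <-] := quot_map_surj q; have [y <-] := quot_map_surj r.
by rewrite -quot_mapD -!quot_mapZ -quot_mapD scalerDr.
Qed.

Lemma quot_scaleDl (q : Q) : {morph quot_scale^~ q : a b / a + b}.
Proof.
move=> a b; have [x <-] := quot_map_surj q.
by rewrite -!quot_mapZ -quot_mapD scalerDl.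
Qed.

HB.instance Definition _ := GRing.Zmodule_isLmodule.Build R Q
  quot_scaleA quot_scale1 quot_scaleDr quot_scaleDl.

Definition quot_norm (q : Q) : R :=
  inf [set `|x| | x in [set x | quot_map x = q]].

Lemma quot_norm_has_inf (q : Q) :
  has_inf [set `|x| | x in [set x | quot_map x = q]].
Proof.
split; last by exists 0 => _ [x _ <-].
by have [x xq] := quot_map_surj q; exists `|x|, x.
Qed.

Lemma quot_norm_le (x : V) : quot_norm (quot_map x) <= `|x|.
Proof.
by apply: ge_inf; [exact: (quot_norm_has_inf _).2|exists x].
Qed.

Lemma quot_norm_ge0 (q : Q) : 0 <= quot_norm q.
Proof.
apply: lb_le_inf; first exact: (quot_norm_has_inf _).1.
by move=> _ [x _ <-].
Qed.

Lemma quot_norm_lt (q : Q) (e : R) : 0 < e ->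
  exists2 x, quot_map x = q & `|x| < quot_norm q + e.
Proof.
move=> e0; have [_ [x xq <-] xe] := inf_adherent e0 (quot_norm_has_inf q).
by exists x.
Qed.

Lemma quot_normD (q r : Q) : quot_norm (q + r) <= quot_norm q + quot_norm r.
Proof.
apply/ler_addgt0Pr => e e0; have e20 : 0 < e / 2 by rewrite divr_gt0.
have [x <- xe] := quot_norm_lt q e20; have [y <- ye] := quot_norm_lt r e20.
rewrite -quot_mapD (le_trans (quot_norm_le _))// (le_trans (ler_normD _ _))//.
by rewrite [e]splitr addrACA lerD// ltW.
Qed.

Lemma quot_norm_leZ (a : R) (q : Q) : quot_norm (a *: q) <= `|a| * quot_norm q.
Proof.
have [->|a0] := eqVneq a 0.
  rewrite scale0r normr0 mul0r -quot_map0.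
  by rewrite (le_trans (quot_norm_le _))// normr0.
apply/ler_addgt0Pr => e e0.
have ea0 : 0 < e / `|a| by rewrite divr_gt0// normr_gt0.
have [x <- xe] := quot_norm_lt q ea0.
rewrite [_ *: _](_ : _ = quot_map (a *: x)); last by rewrite quot_mapZ.
rewrite (le_trans (quot_norm_le _))// normrZ.
rewrite -ler_pdivlMl ?normr_gt0// mulrDr mulKf ?normr_eq0// mulrC ltW//.
Qed.

Lemma quot_normZ (a : R) (q : Q) : quot_norm (a *: q) = `|a| * quot_norm q.
Proof.
apply/eqP; rewrite eq_le quot_norm_leZ /=.
have [->|a0] := eqVneq a 0; first by rewrite normr0 mul0r quot_norm_ge0.
rewrite -ler_pdivlMl ?normr_gt0// -normfV.
by rewrite -{1}[q](scalerK a0) quot_norm_leZ.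
Qed.

Lemma quot_norm0_eq0 (q : Q) : quot_norm q = 0 -> q = 0.
Proof.
have [x <-] := quot_map_surj q => x0.
rewrite -quot_map0; apply/quot_mapP.
rewrite subr0; apply: csub_closed => U /nbhs_normP[e /= e0 eU].
have [y yx] := quot_norm_lt (quot_map x) e0; rewrite x0 add0r => ye.
exists (x - y); split; first by apply/quot_mapP.
by apply: eU => /=; rewrite opprB addrC subrK.
Qed.

HB.instance Definition _ := Lmodule_isNormed.Build R Q
  quot_normD quot_normZ quot_norm0_eq0.

Lemma quot_normE (q : Q) : `|q| = quot_norm q.
Proof. by []. Qed.

Definition quot_cone (C : set V) : set Q := closure (quot_map @` C).

End QuotientSpace.

Definition dual_pred (R : realType) (V : normedModType R) : {pred V -> R} :=
  [pred f : V -> R | `[< scalar f /\ continuous f >]].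

Arguments dual_pred {R} V _.

Record dualSpace (R : realType) (V : normedModType R) :=
  DualSpace { dual_val :> V -> R ; _ : dual_val \in dual_pred V }.

Section DualSpace.
Context {R : realType} {V : normedModType R}.
Local Notation D := (dualSpace V).

Lemma dual_submod_closed : submod_closed (dual_pred V).
Proof.
split; first by apply/asboolP; split=> [a x y|];
  [rewrite mulr0 addr0|exact: cst_continuous].
move=> a f g /asboolP[fl fc] /asboolP[gl gc]; apply/asboolP; split.
  move=> b x y; rewrite /= !fctE /GRing.scale /= fl gl; ring.
by move=> x; apply: continuousD; [apply: continuousZr; exact: fc|exact: gc].
Qed.

HB.instance Definition _ := GRing.isSubmodClosed.Build R (V -> R) (dual_pred V)
  dual_submod_closed.

HB.instance Definition _ := [isSub for @dual_val R V].
HB.instance Definition _ := [Choice of D by <:].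
HB.instance Definition _ := [SubChoice_isSubLmodule of D by <:].

Lemma dual_scalar (f : D) : scalar f.
Proof. by have /asboolP[] := valP f. Qed.

Lemma dual_continuous (f : D) : continuous f.
Proof. by have /asboolP[] := valP f. Qed.

HB.instance Definition _ (f : D) :=
  GRing.isLinear.Build R V R *%R (dual_val f) (dual_scalar f).

Lemma dual_addE (f g : D) (x : V) : (f + g) x = f x + g x.
Proof. by []. Qed.

Lemma dual_scaleE (a : R) (f : D) (x : V) : (a *: f) x = a * f x.
Proof. by []. Qed.

Definition dual_norm (f : D) : R := sup [set `|f x| | x in [set x | `|x| <= 1]].

Lemma dual_bounded (f : D) : exists2 M, 0 < M & forall x, `|f x| <= M * `|x|.
Proof.
have /linear_boundedP/pinfty_ex_gt0[M M0 fM] :=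
  @continuous_linear_bounded R V R 0 f (@dual_continuous f 0).
by exists M.
Qed.

Lemma dual_norm_has_sup (f : D) :
  has_sup [set `|f x| | x in [set x | `|x| <= 1]].
Proof.
split; first by exists `|f 0|, 0 => //=; rewrite normr0.
have [M M0 fM] := dual_bounded f; exists M => _ [x /= x1 <-].
by rewrite (le_trans (fM x))// ler_piMr// ltW.
Qed.

Lemma dual_norm_ge (f : D) (x : V) : `|f x| <= dual_norm f * `|x|.
Proof.
have [->|x0] := eqVneq x 0; first by rewrite raddf0 !normr0 mulr0.
rewrite -ler_pdivrMr ?normr_gt0// -[leLHS](_ : `|f (`|x|^-1 *: x)| = _).
  apply: (ub_le_sup (dual_norm_has_sup f).2).
  by exists (`|x|^-1 *: x) => //=; rewrite normfZV.
by rewrite linearZ /= normrM normfV normr_id mulrC.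
Qed.

Lemma dual_norm_le (f : D) (M : R) : 0 <= M ->
  (forall x, `|f x| <= M * `|x|) -> dual_norm f <= M.
Proof.
move=> M0 fM; apply: ge_sup; first exact: (dual_norm_has_sup f).1.
by move=> _ [x /= x1 <-]; rewrite (le_trans (fM x))// ler_piMr.
Qed.

Lemma dual_norm_ge0 (f : D) : 0 <= dual_norm f.
Proof.
rewrite (le_trans (normr_ge0 (f 0)))//.
apply: (ub_le_sup (dual_norm_has_sup f).2).
by exists 0 => //=; rewrite normr0.
Qed.

Lemma dual_normD (f g : D) : dual_norm (f + g) <= dual_norm f + dual_norm g.
Proof.
apply: dual_norm_le => [|x]; first by rewrite addr_ge0// dual_norm_ge0.
rewrite dual_addE mulrDl (le_trans (ler_normD _ _))//.
by rewrite lerD// dual_norm_ge.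
Qed.

Lemma dual_norm_leZ (a : R) (f : D) : dual_norm (a *: f) <= `|a| * dual_norm f.
Proof.
apply: dual_norm_le => [|x]; first by rewrite mulr_ge0// dual_norm_ge0.
by rewrite dual_scaleE normrM -mulrA ler_wpM2l// dual_norm_ge.
Qed.

Lemma dual_normZ (a : R) (f : D) : dual_norm (a *: f) = `|a| * dual_norm f.
Proof.
apply/eqP; rewrite eq_le dual_norm_leZ /=.
have [->|a0] := eqVneq a 0; first by rewrite normr0 mul0r dual_norm_ge0.
rewrite -ler_pdivlMl ?normr_gt0// -normfV.
by rewrite -{1}[f](scalerK a0) dual_norm_leZ.
Qed.

Lemma dual_norm0_eq0 (f : D) : dual_norm f = 0 -> f = 0.
Proof.
move=> f0; apply: val_inj; apply/funext => x; apply/eqP.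
by rewrite -normr_le0 (le_trans (dual_norm_ge f x))// f0 mul0r.
Qed.

HB.instance Definition _ := Lmodule_isNormed.Build R D
  dual_normD dual_normZ dual_norm0_eq0.

Lemma dual_normE (f : D) : `|f| = dual_norm f.
Proof. by []. Qed.

Lemma dual_eval_continuous (x : V) : continuous (fun f : D => f x).
Proof.
move=> f; apply/(@cvgrPdist_le _ _ _ (nbhs f)) => e e0.
have x1 : 0 < `|x| + 1 by rewrite ltr_wpDl.
near=> g; rewrite (_ : f x - g x = (f - g) x)//.
rewrite (le_trans (dual_norm_ge _ x))//.
rewrite (@le_trans _ _ (dual_norm (f - g) * (`|x| + 1)))//.
  by rewrite ler_wpM2l ?dual_norm_ge0// lerDl.
rewrite -ler_pdivlMr// -[dual_norm _]/(`|f - g|).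
by near: g; apply: cvgr_dist_le => //; rewrite divr_gt0.
Unshelve. all: by end_near. Qed.

Definition dual_cone (C : set V) : set D :=
  [set f : D | forall v, C v -> 0 <= f v].

(* V^* with its weak* topology, the topology of pointwise convergence. *)
Definition weak_star : Type :=
  initial_topology (@dual_val R V : D -> {ptws V -> R}).

HB.instance Definition _ := Topological.copy weak_star
  (initial_topology (@dual_val R V : D -> {ptws V -> R})).

End DualSpace.

Arguments weak_star {R} V.

Section Annihilator.
Context {R : realType} {V : normedModType R} (W : closedSubspace V).

Definition annihilator_set : set (dualSpace V) :=
  [set f : dualSpace V | forall w, csub_set W w -> f w = 0].

Lemma annihilator_submod :
  submod_closed [pred f | f \in annihilator_set].
Proof.
split; first exact: mem_set.
move=> a f g /set_mem f0 /set_mem g0; apply/mem_set => w Ww.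
by rewrite dual_addE dual_scaleE f0// g0// mulr0 addr0.
Qed.

Lemma annihilator_closed : closed annihilator_set.
Proof.
rewrite [annihilator_set](_ : _ = \bigcap_(w in csub_set W)
  ((fun f : dualSpace V => f w) @^-1` [set 0])); last by apply/seteqP; split.
apply: closed_bigI => w _; apply: preimage_closed; last exact: (@closed_eq R 0).
by move=> f _; exact: dual_eval_continuous.
Qed.

Definition annihilator : closedSubspace (dualSpace V) :=
  ClosedSubspace annihilator_submod annihilator_closed.

Lemma annihilatorE (f : dualSpace V) :
  csub_set annihilator f <-> forall w, csub_set W w -> f w = 0.
Proof. by []. Qed.

Lemma dual_restr_subproof (f : dualSpace V) :
  (fun w : csubType W => f (val w)) \in dual_pred (csubType W).
Proof.
apply/asboolP; split=> [a x y|x]; first by rewrite !linearP.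
by apply: continuous_comp; [exact: csub_val_continuous|exact: dual_continuous].
Qed.

Definition dual_restr (f : dualSpace V) : dualSpace (csubType W) :=
  DualSpace (dual_restr_subproof f).

(* The identification of V^*/W^perp with W^*, sending the class of f to the
   restriction of f to W; quot_dual_restrE shows that the choice of the
   representative is immaterial. *)
Definition quot_dual_restr (q : quotSpace annihilator) :
  dualSpace (csubType W) := dual_restr (repr q).

Lemma quot_dual_restrE (f : dualSpace V) :
  quot_dual_restr (quot_map annihilator f) = dual_restr f.
Proof.
apply: val_inj; apply/funext => w; apply/eqP; rewrite -subr_eq0; apply/eqP.
rewrite /quot_dual_restr /=; set g := repr _.
have : csub_set annihilator (g - f).
  by apply/quot_mapP; rewrite /g /quot_map reprK.
by apply; apply/csub_predE; exact: valP.
Qed.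

(* V^*/W^perp with the weak* topology of W^*, pulled back along the
   identification quot_dual_restr. *)
Definition weak_star_quot : Type :=
  initial_topology
    (quot_dual_restr : quotSpace annihilator -> weak_star (csubType W)).

HB.instance Definition _ := Topological.copy weak_star_quot
  (initial_topology
    (quot_dual_restr : quotSpace annihilator -> weak_star (csubType W))).

Definition quot_dual_cone (C : set V) : set (quotSpace annihilator) :=
  closure (quot_map annihilator @` dual_cone C : set weak_star_quot).

End Annihilator.

Arguments sub_cone {R V} W C _.
Arguments quot_cone {R V} W C _.
Arguments quot_dual_cone {R V} W C _.

(* Main.v *)
Require Import Defs.
From HB Require Import structures.
From mathcomp Require Import all_boot all_order all_algebra.
From mathcomp Require Import all_classical all_reals all_analysis.
From mathcomp Require Import ring lra.

(** A Banach space [X] with a closed cone is order smooth with exponent [p] if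
    and only if its dual, with the dual cone, is order smooth with exponent [p']
    and satisfies (OS.p'.2).  Both parts are this equivalence, for [X = W] and
    [X = V/W], transported along [W^* = V^*/W^perp] (where the weak* closure of
    the image cone is the dual cone of [W^+], by the bipolar theorem) and
    [(V/W)^* = W^perp].

    (O.p.1) for [X] and (OS.p'.2) for [X^*] correspond through a Hahn-Banach
    extension from the antidiagonal of [X * X] with the [p]-sum norm, and
    (O.p.2) gives (O.p'.1) by Hoelder.  From (O.p'.1) in [X^*] to (O.p.2) in [X],
    Hahn-Banach on [X * X * X] shows that every vector is approximated by
    differences of positive elements with almost the right [p]-sum norm;
    completeness and a geometric series of corrections make this exact. *)

Set Implicit Arguments.
Unset Strict Implicit.
Unset Printing Implicit Defensive.

Import Order.TTheory GRing.Theory Num.Theory.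
Import numFieldNormedType.Exports.

Local Open Scope classical_set_scope.
Local Open Scope ring_scope.

(** * Sublinear functionals and the Hahn-Banach theorem *)

Section HahnBanach.
Context {R : realType} {E : lmodType R}.
Implicit Types (q : E -> R) (P : set (E * R)).

(** Only one inequality is asked for positive scalars; applying it to the inverse scalar gives
    equality. *)
Definition sublinear q :=
  (forall x y, q (x + y) <= q x + q y) /\
  (forall a x, 0 < a -> q (a *: x) <= a * q x).

Lemma sublinear0 q : sublinear q -> q 0 = 0.
Proof.
move=> [_ qZ]; have := qZ 2 0 ltac:(lra); have := qZ 2^-1 0 ltac:(lra).
by rewrite !scaler0; lra.
Qed.

Lemma sublinearZ q a x : sublinear q -> 0 <= a -> q (a *: x) = a * q x.
Proof.
move=> sq; rewrite le_eqVlt => /predU1P[<-|a0].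
  by rewrite scale0r mul0r sublinear0.
apply/le_anti; rewrite (sq.2 _ _ a0)/= -ler_pdivlMl//.
by rewrite -[in leLHS](scalerK (lt0r_neq0 a0) x) sq.2// invr_gt0.
Qed.

(* The largest sublinear functional [q' <= q] with [q' (- y) <= - r] for every
   [(y, r)] in [P]: a linear functional below it is at least [r] at [y]. *)
Definition lowered q P (x : E) : R := inf [set q (x + y.1) - y.2 | y in P].

Definition pair_cone P :=
  [/\ P (0, 0), forall y z, P y -> P z -> P (y.1 + z.1, y.2 + z.2) &
   forall a y, 0 < a -> P y -> P (a *: y.1, a * y.2)].

Section lowered.
Variables (q : E -> R) (P : set (E * R)).
Hypotheses (sq : sublinear q) (Pc : pair_cone P).
Hypothesis Pq : forall y, P y -> y.2 <= q y.1.

Let lowered_has_inf x : has_inf [set q (x + y.1) - y.2 | y in P].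
Proof.
have [P0 _ _] := Pc; split; first by exists (q (x + 0) - 0), (0, 0).
(* Lower bound: [y.2 <= q y.1 <= q (- x) + q (x + y.1)]. *)
exists (- q (- x)) => _ [y Py <-].
have := sq.1 (- x) (x + y.1); rewrite addKr.
by have := Pq Py; lra.
Qed.

Lemma lowered_le x y : P y -> lowered q P x <= q (x + y.1) - y.2.
Proof.
by move=> Py; apply: ge_inf; [exact: (lowered_has_inf x).2|exists y].
Qed.

Lemma lowered_sublinear : sublinear (lowered q P).
Proof.
have [P0 PD PZ] := Pc; split=> [x y|a x a0].
  apply/ler_addgt0Pr => e e0; have e20 : 0 < e / 2 by rewrite divr_gt0.
  have [_ [u Pu <-] hu] := inf_adherent e20 (lowered_has_inf x).
  have [_ [v Pv <-] hv] := inf_adherent e20 (lowered_has_inf y).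
  have := lowered_le (x + y) (PD _ _ Pu Pv); rewrite /= addrACA.
  move: hu hv (sq.1 (x + u.1) (y + v.1)); rewrite /lowered; lra.
rewrite -ler_pdivrMl//; apply: lb_le_inf; first exact: (lowered_has_inf x).1.
move=> _ [y Py <-]; rewrite ler_pdivrMl// mulrBr.
have := lowered_le (a *: x) (PZ a y a0 Py); rewrite /= -scalerDr.
by have := sq.2 a (x + y.1) a0; lra.
Qed.

Lemma lowered_le_self x : lowered q P x <= q x.
Proof. by have [P0 _ _] := Pc; have := lowered_le x P0; rewrite /= addr0 subr0. Qed.

Lemma lowered_opp y : P y -> lowered q P (- y.1) <= - y.2.
Proof. by move=> /(lowered_le (- y.1)); rewrite addNr sublinear0// add0r. Qed.

End lowered.

(* A minimal sublinear functional [m] is linear: lowering it along the ray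
   of [x] cannot change it, hence [m (- x) = - m x]. *)
Lemma minimal_sublinear_scalar (m : E -> R) : sublinear m ->
  (forall q, sublinear q -> (forall x, q x <= m x) -> q = m) -> scalar m.
Proof.
move=> sm mmin.
have mN x : m (- x) = - m x.
  pose P := [set y : E * R | exists2 t, 0 <= t & y = (t *: x, t * m x)].
  have Pc : pair_cone P.
    split; first by exists 0 => //; rewrite scale0r mul0r.
      move=> _ _ [s s0 ->] [t t0 ->]; exists (s + t); first exact: addr_ge0.
      by rewrite scalerDl mulrDl.
    move=> a _ a0 [t t0 ->]; exists (a * t); first by rewrite mulr_ge0// ltW.
    by rewrite scalerA mulrA.
  have Pm y : P y -> y.2 <= m y.1 by move=> [t t0 ->] /=; rewrite sublinearZ.
  have Px : P (x, m x) by exists 1; rewrite ?scale1r ?mul1r.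
  have := lowered_opp sm Pc Pm Px.
  rewrite (mmin _ (lowered_sublinear sm Pc Pm) (lowered_le_self sm Pc Pm)) /=.
  by have := sm.1 x (- x); rewrite subrr sublinear0//; lra.
have mD x y : m (x + y) = m x + m y.
  by have := sm.1 x y; have := sm.1 (x + y) (- y); rewrite addrK mN; lra.
have mZ a x : m (a *: x) = a * m x.
  have [a0|a0] := leP 0 a; first exact: sublinearZ.
  rewrite -[a]opprK scaleNr mN sublinearZ ?oppr_ge0 ?ltW//; lra.
by move=> a x y; rewrite mD mZ.
Qed.

(** Zorn's lemma for the reversed pointwise order. The infimum of a chain is finite because
    [- q (- x)] bounds it below, and subadditive because of two near-minimizers, one at [x] and one
    at [y], the smaller one serves at both points. *)
Lemma sublinear_minimal q : sublinear q -> exists m, [/\ sublinear m,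
  (forall x, m x <= q x) &
  (forall q', sublinear q' -> (forall x, q' x <= m x) -> q' = m)].
Proof.
move=> sq; pose T := {m : E -> R | sublinear m /\ forall x, m x <= q x}.
pose r (m n : T) := `[< forall x, sval n x <= sval m x >].
have [||||m mmax] := @Zorn T r.
- by move=> m; exact/asboolP.
- move=> m n l /asboolP mn /asboolP nl; apply/asboolP => x.
  exact: le_trans (nl x) (mn x).
- move=> [m Hm] [n Hn] /asboolP/= mn /asboolP/= nm.
  have mnE : m = n by apply/funext => x; apply/le_anti; rewrite mn nm.
  by case: _ / mnE Hn nm mn => Hn _ _; congr exist; exact: Prop_irrelevance.
(* The empty chain is bounded by [q] itself. *)
- move=> A Atot; have [[a Aa]|A0] := pselect (A !=set0); last first.
    exists (exist _ q (conj sq (fun x => lexx _)) : T) => s As.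
    by exfalso; apply: A0; exists s.
  pose I x := [set sval m x | m in A].
  have I0 x : has_inf (I x).
    split; first by exists (sval a x), a.
    exists (- q (- x)) => _ [m Am <-]; have [sm mq] := svalP m.
    have := mq (- x); have := sm.1 x (- x); rewrite subrr sublinear0//; lra.
  have Ile x m : A m -> inf (I x) <= sval m x.
    by move=> Am; apply: ge_inf; [exact: (I0 x).2|exists m].
  have sI : sublinear (fun x => inf (I x)).
    split=> [x y|b x b0].
      apply/ler_addgt0Pr => e e0; have e20 : 0 < e / 2 by rewrite divr_gt0.
      have [_ [m Am <-] hm] := inf_adherent e20 (I0 x).
      have [_ [n An <-] hn] := inf_adherent e20 (I0 y).
      have := (svalP m).1.1 x y; have := (svalP n).1.1 x y.
      have := Ile (x + y) _ Am; have := Ile (x + y) _ An.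
      by have [/asboolP mn|/asboolP mn] := Atot _ _ Am An;
        have := mn x; have := mn y; move: hm hn; lra.
    rewrite -ler_pdivrMl//; apply: lb_le_inf; first exact: (I0 x).1.
    move=> _ [m Am <-]; rewrite ler_pdivrMl//.
    by rewrite (le_trans (Ile _ _ Am))// (svalP m).1.2.
  have Iq x : inf (I x) <= q x.
    by rewrite (le_trans (Ile x _ Aa))// (svalP a).2.
  exists (exist _ (fun x => inf (I x)) (conj sI Iq) : T) => s As; apply/asboolP => x /=.
  exact: Ile.
have [sm mq] := svalP m; exists (sval m); split=> // n sn nm.
have nq x : n x <= q x by exact: le_trans (nm x) (mq x).
have /(congr1 sval) := mmax (exist _ n (conj sn nq) : T) (introT (asboolP _) nm).
by [].
Qed.

(** A minimal sublinear functional below [lowered q P] is linear, and linearity turns its upper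
    bound at [- y.1] into the required lower bound at [y.1]. Every extension and separation argument
    below is a choice of [q] and [P]. *)
Lemma mazur_orlicz q P : sublinear q -> pair_cone P ->
  (forall y, P y -> y.2 <= q y.1) ->
  exists F : {scalar E}, (forall x, F x <= q x) /\ (forall y, P y -> y.2 <= F y.1).
Proof.
move=> sq Pc Pq.
have [m [sm mq mmin]] := sublinear_minimal (lowered_sublinear sq Pc Pq).
pose F : {scalar E} := HB.pack m
  (GRing.isLinear.Build R E R *%R m (minimal_sublinear_scalar sm mmin)).
exists F; split=> [x|y Py].
  exact: le_trans (mq x) (lowered_le_self sq Pc Pq x).
rewrite -lerN2 -(raddfN F).
exact: le_trans (mq _) (lowered_opp sq Pc Pq Py).
Qed.

End HahnBanach.

(** * Two-term p-norms *)

Section PCombination.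
Context {R : realType}.
Implicit Types (p : \bar R) (a b c d s t : R).
Local Notation "p ^*" := (hoelder_conjugate p) : ereal_scope.

Lemma hoelder_conjugate_cases p : (1 <= p)%E ->
  [\/ p = 1%E /\ p^*%E = +oo%E, p = +oo%E /\ p^*%E = 1%E |
   exists r s, [/\ p = r%:E, p^*%E = s%:E, 1 < r, 1 < s & r^-1 + s^-1 = 1] ].
Proof.
move=> p1; have [->|pn1] := eqVneq p 1%E.
  by apply: Or31; rewrite hoelder_conjugate1.
have [->|pny] := eqVneq p +oo%E.
  by apply: Or32; rewrite hoelder_conjugatey.
apply: Or33; case: p p1 pn1 pny => [r| |]// r1 rn1 _.
rewrite lee_fin in r1; rewrite eqe in rn1.
have {r1 rn1} r1 : 1 < r by rewrite lt_neqAle eq_sym rn1.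
have r0 : r != 0 by lra. have rm0 : r - 1 != 0 by lra.
exists r, (r / (r - 1)); split=> //.
- rewrite /hoelder_conjugate/= eqe (negbTE r0) -EFinD inver.
  by rewrite (negbTE rm0).
- by rewrite ltr_pdivlMr; lra.
- by field; rewrite rm0 r0.
Qed.

Lemma pcomb1 a b : 0 <= a -> 0 <= b -> pcomb 1%E a b = a + b.
Proof. by move=> a0 b0; rewrite /pcomb/= invr1 !powRr1// addr_ge0. Qed.

Lemma pcombC p a b : pcomb p a b = pcomb p b a.
Proof.
case: p => [r| |]; last by [].
- exact: (congr1 (fun x : R => x `^ r^-1) (addrC (a `^ r) (b `^ r))).
- exact: (@maxC _ R a b).
Qed.

Lemma pcomb_ge0 p a b : 0 <= a -> 0 <= pcomb p a b.
Proof. by case: p => [r| |] //= a0; rewrite ?powR_ge0// le_max a0. Qed.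

Lemma pcomb_hoelder p a b c d : (1 <= p)%E ->
  0 <= a -> 0 <= b -> 0 <= c -> 0 <= d ->
  a * c + b * d <= pcomb p a b * pcomb p^*%E c d.
Proof.
move=> /hoelder_conjugate_cases[[-> ->]|[-> ->]|[r [s [-> -> r1 s1 rs]]]] a0 b0 c0 d0.
- rewrite pcomb1//= mulrDl lerD// ler_wpM2l// le_max lexx ?orbT//.
- rewrite pcomb1//= mulrDr lerD// ler_wpM2r// le_max lexx ?orbT//.
- rewrite /=; apply: hoelder2 => //; lra.
Qed.

(* For [1 < p < oo] the extremal pair is
   [(a `^ (p^* - 1), b `^ (p^* - 1))]. *)
Lemma pcomb_dual_le p a b M : (1 <= p)%E -> 0 <= a -> 0 <= b -> 0 <= M ->
  (forall s t, 0 <= s -> 0 <= t -> s * a + t * b <= M * pcomb p s t) ->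
  pcomb p^*%E a b <= M.
Proof.
move=> /hoelder_conjugate_cases[[-> ->]|[-> ->]|[r [s [-> -> r1 s1 rs]]]] a0 b0 M0 abM.
- have := abM 1 0 ler01 (lexx _); have := abM 0 1 (lexx _) ler01.
  rewrite !pcomb1// /= ge_max; lra.
- have := abM 1 1 ler01 ler01; rewrite pcomb1//= maxxx; lra.
- rewrite /= in abM *; have s0 : s != 0 by lra. have r0 : r != 0 by lra.
  have sr : (s - 1) * r = s.
    have : r * s * (r^-1 + s^-1) = r * s by rewrite rs mulr1.
    rewrite mulrDr mulrAC divff// mul1r -mulrA divff// mulr1; nra.
  set N := a `^ s + b `^ s.
  have N0 : 0 <= N by rewrite addr_ge0// powR_ge0.
  have powM x : 0 <= x -> x `^ (s - 1) * x = x `^ s.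
    move=> x0; rewrite -{2}(powRr1 x0) -powRD ?subrK//.
    by rewrite (negbTE s0).
  (* The extremal pair gives [N <= M * N]^ r^-1[; dividing leaves]N [^ s^-1 <= M], since
     [1 - r^-1 = s^-1]. *)
  have := abM _ _ (powR_ge0 a (s - 1)) (powR_ge0 b (s - 1)).
  rewrite !powM// -!powRrM sr -/N => NM.
  have [->|Nn0] := eqVneq N 0; first by rewrite powR0// invr_neq0.
  have Np : 0 < N `^ r^-1 by rewrite powR_gt0// lt_neqAle eq_sym Nn0.
  rewrite -(ler_pM2r Np) -powRD; last by rewrite Nn0 implybT.
  by rewrite addrC rs powRr1.
Qed.

(** Hoelder against the pair [(1, 0)], whose conjugate norm is at most 1. *)
Lemma le_pcombl p a b : (1 <= p)%E -> 0 <= a -> 0 <= b -> a <= pcomb p a b.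
Proof.
move=> p1 a0 b0; have := pcomb_hoelder p1 a0 b0 ler01 (lexx 0).
rewrite mulr1 mulr0 addr0 => /le_trans; apply; rewrite ler_piMr ?pcomb_ge0//.
case: (hoelder_conjugate_cases p1) => [[_ ->]|[_ ->]|[r [s [_ -> _ s1 _]]]].
- by rewrite /= ge_max lexx ler01.
- by rewrite pcomb1// addr0.
- have s0 : s != 0 by rewrite gt_eqF// (lt_trans ltr01).
  by rewrite /= powR1 powR0// addr0 powR1.
Qed.

(* [pcomb p] is a supremum of linear forms, from which monotonicity and the
   triangle inequality are read off. *)
Section duality_consequences.
Variable p : \bar R.
Hypothesis p1 : (1 <= p)%E.

Let dual_le a b M : 0 <= a -> 0 <= b -> 0 <= M ->
  (forall s t, 0 <= s -> 0 <= t -> s * a + t * b <= M * pcomb p^*%E s t) ->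
  pcomb p a b <= M.
Proof.
move=> a0 b0 M0 H; rewrite -(hoelder_conjugateK p).
by apply: pcomb_dual_le => //; exact: hoelder_conj_ge1.
Qed.

Let hoelder_mul a b s t : 0 <= a -> 0 <= b -> 0 <= s -> 0 <= t ->
  s * a + t * b <= pcomb p a b * pcomb p^*%E s t.
Proof. by move=> *; rewrite mulrC (mulrC t); apply: pcomb_hoelder. Qed.

Lemma pcomb_le a b c d : 0 <= a -> 0 <= b -> a <= c -> b <= d ->
  pcomb p a b <= pcomb p c d.
Proof.
move=> a0 b0 ac bd; have c0 := le_trans a0 ac; have d0 := le_trans b0 bd.
apply: dual_le => // [|s t s0 t0]; first exact: pcomb_ge0.
rewrite (le_trans _ (hoelder_mul c0 d0 s0 t0))//.
by rewrite lerD// ler_wpM2l.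
Qed.

Lemma pcombD a b c d : 0 <= a -> 0 <= b -> 0 <= c -> 0 <= d ->
  pcomb p (a + c) (b + d) <= pcomb p a b + pcomb p c d.
Proof.
move=> a0 b0 c0 d0.
apply: dual_le; rewrite ?addr_ge0 ?pcomb_ge0// => s t s0 t0.
have := hoelder_mul a0 b0 s0 t0; have := hoelder_mul c0 d0 s0 t0; lra.
Qed.

Lemma pcomb_leZ k a b : 0 <= k -> 0 <= a -> 0 <= b ->
  pcomb p (k * a) (k * b) <= k * pcomb p a b.
Proof.
move=> k0 a0 b0; apply: dual_le; rewrite ?mulr_ge0 ?pcomb_ge0// => s t s0 t0.
have := ler_wpM2l k0 (hoelder_mul a0 b0 s0 t0); lra.
Qed.

Lemma pcomb_le_add a b : 0 <= a -> 0 <= b -> pcomb p a b <= a + b.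
Proof.
move=> a0 b0; apply: dual_le => //[|s t s0 t0]; first exact: addr_ge0.
have q1 := hoelder_conj_ge1 p1.
rewrite mulrDl lerD// mulrC ler_wpM2l// ?le_pcombl//.
by rewrite pcombC le_pcombl.
Qed.

End duality_consequences.
End PCombination.

(** * Duality of order smooth norms *)

Section BoundedFunctionals.
Context {R : realType} {X : normedModType R}.

(** A one-sided bound suffices: at [- x] it bounds [F x] from below. *)
Lemma scalar_dual (F : X -> R) (M : R) : scalar F -> 0 <= M ->
  (forall x, F x <= M * `|x|) ->
  exists f : dualSpace X, (forall x, f x = F x) /\ `|f| <= M.
Proof.
move=> Flin M0 FM.
pose G : {scalar X} := HB.pack F (GRing.isLinear.Build R X R *%R F Flin).
have absFM x : `|F x| <= M * `|x|.
  by rewrite ler_norml FM andbT lerNl -(raddfN G) (le_trans (FM _))// normrN.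
have Fp : (F : X -> R) \in dual_pred X.
  apply/asboolP; split=> //; apply: (@bounded_linear_continuous R X R G); apply/linear_boundedP.
  exists M; split=> [|r Mr x]; first exact: num_real.
  by rewrite (le_trans (absFM x))// ler_wpM2r// ltW.
exists (DualSpace Fp); split=> //; exact: dual_norm_le.
Qed.

Lemma norm_scale_sublinear (M : R) : 0 <= M ->
  sublinear (fun x : X => M * `|x|).
Proof.
move=> M0; split=> [x y|a x a0]; first by rewrite -mulrDr ler_wpM2l// ler_normD.
by rewrite normrZ gtr0_norm// mulrCA.
Qed.

Lemma dual_oppE (f : dualSpace X) (x : X) : (- f) x = - f x.
Proof. by rewrite -scaleN1r dual_scaleE mulN1r. Qed.

Lemma dual_subE (f g : dualSpace X) (x : X) : (f - g) x = f x - g x.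
Proof. by rewrite dual_addE dual_oppE. Qed.

Lemma dual_le_norm (f : dualSpace X) (x : X) : f x <= `|f| * `|x|.
Proof. by rewrite (le_trans (ler_norm _))// dual_norm_ge. Qed.

Lemma dual_norm_le_ball (f : dualSpace X) (B : R) :
  (forall x, `|x| <= 1 -> f x <= B) -> `|f| <= B.
Proof.
move=> fB; apply: ge_sup; first exact: (dual_norm_has_sup f).1.
move=> _ [x /= x1 <-]; rewrite ler_norml fB// andbT lerNl -raddfN.
by rewrite fB// normrN.
Qed.

(** The norm dual to the [p]-sum norm on [X * X] is the [p']-sum of the dual norms. The bound is
    tested at [(s *: x, t *: y)] with [x], [y] in the unit ball, and the two suprema are taken one
    after the other. *)
Lemma pcomb_dual_norm (p : \bar R) (g h : dualSpace X) (M : R) :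
  (1 <= p)%E -> 0 <= M ->
  (forall x y, g x + h y <= M * pcomb p `|x| `|y|) ->
  pcomb (hoelder_conjugate p) `|g| `|h| <= M.
Proof.
move=> p1 M0 ghM; apply: pcomb_dual_le => // s t s0 t0.
have st x y : `|x| <= 1 -> `|y| <= 1 -> s * g x + t * h y <= M * pcomb p s t.
  move=> x1 y1; have := ghM (s *: x) (t *: y); rewrite !linearZ/=.
  move/le_trans; apply; rewrite ler_wpM2l//.
  by apply: pcomb_le => //; rewrite normrZ ger0_norm// ler_piMr.
rewrite -lerBrDl -{1}(ger0_norm t0) -normrZ.
apply: dual_norm_le_ball => y y1; rewrite dual_scaleE lerBrDr -lerBrDl.
rewrite -{1}(ger0_norm s0) -normrZ.
apply: dual_norm_le_ball => x x1; rewrite dual_scaleE lerBrDr.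
exact: st.
Qed.

(** Mazur-Orlicz for the cone generated by [(x0, m)] and the pairs [(k, 0)]. Homogeneity reduces the
    domination by [q] to the coefficients 1 and 0 of [x0], which are the last two hypotheses. *)
Lemma cone_separation (E : lmodType R) (q : E -> R) (K : set E) (x0 : E) (m : R) :
  sublinear q -> K 0 -> (forall x y, K x -> K y -> K (x + y)) ->
  (forall a x, 0 < a -> K x -> K (a *: x)) ->
  (forall k, K k -> m <= q (x0 + k)) -> (forall k, K k -> 0 <= q k) ->
  exists F : {scalar E},
    [/\ forall x, F x <= q x, m <= F x0 & forall k, K k -> 0 <= F k].
Proof.
move=> sq K0 KD KZ mq q0.
pose P := [set y : E * R | exists t k, [/\ 0 <= t, K k &
  y = (t *: x0 + k, t * m)]].
have [||F [Fq FP]] := @mazur_orlicz _ _ q P sq.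
- split; first by exists 0, 0; rewrite scale0r mul0r addr0.
  + move=> _ _ [t [k [t0 Kk ->]]] [s [l [s0 Kl ->]]] /=.
    exists (t + s), (k + l); split; [exact: addr_ge0|exact: KD|].
    by rewrite scalerDl mulrDl addrACA.
  + move=> a _ a0 [t [k [t0 Kk ->]]] /=.
    exists (a * t), (a *: k); split; [by rewrite mulr_ge0// ltW|exact: KZ|].
    by rewrite scalerDr scalerA mulrA.
- move=> _ [t [k [t0 Kk ->]]] /=; move: t0; rewrite le_eqVlt.
  move=> /predU1P[<-|t0]; first by rewrite mul0r scale0r add0r q0.
  have -> : k = t *: (t^-1 *: k) by rewrite scalerA divff ?scale1r// gt_eqF.
  rewrite -scalerDr (sublinearZ _ sq (ltW t0)) ler_pM2l// mq//.
  by apply: KZ => //; rewrite invr_gt0.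
- exists F; split=> // [|k Kk].
    by apply: (FP (x0, m)); exists 1, 0; rewrite scale1r mul1r addr0.
  by apply: (FP (k, 0)); exists 0, k; rewrite scale0r mul0r add0r.
Qed.

Lemma norming_functional (x : X) :
  exists f : dualSpace X, `|f| <= 1 /\ f x = `|x|.
Proof.
have [||||F [Fq Fx _]] :=
  @cone_separation _ _ [set 0] x `|x| (norm_scale_sublinear ler01) erefl.
- by move=> _ _ -> ->; rewrite addr0.
- by move=> a _ _ ->; rewrite scaler0.
- by move=> _ ->; rewrite addr0 mul1r.
- by move=> _ ->; rewrite normr0 mulr0.
have [f [fF f1]] := scalar_dual (@linearP _ _ _ _ F) ler01 Fq.
by exists f; split=> //; apply/le_anti; rewrite fF Fx andbT -[leRHS]mul1r.
Qed.

End BoundedFunctionals.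

(** * Transfer of the norm conditions between a space and its dual *)

Section Duality.
Context {R : realType} {X : normedModType R}.
Variables (p : \bar R) (C : set X).
Hypotheses (p1 : (1 <= p)%E) (Ccone : is_cone C) (C0 : C 0).
Local Notation p' := (hoelder_conjugate p).

Let p'1 : (1 <= p')%E. Proof. exact: hoelder_conj_ge1. Qed.

Lemma coneD x y : C x -> C y -> C (x + y).
Proof. by move=> Cx Cy; rewrite -[x]scale1r; apply: Ccone. Qed.

Lemma coneZ a x : 0 <= a -> C x -> C (a *: x).
Proof. by move=> a0 Cx; rewrite -[_ *: _]addr0; apply: Ccone. Qed.

Lemma dual_coneB (f g : dualSpace X) : cone_le (dual_cone C) f g <->
  forall x, C x -> f x <= g x.
Proof.
by split=> fg x /fg; rewrite dual_subE subr_ge0.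
Qed.

(* A linear form on [X * X] bounded by [q] and by [f] from below at the points
   [(x + a, b - x)], [a] and [b] positive, is [(g, h)] with [g], [h] positive and
   [f = g - h]; (O.p.1) says precisely that these lower bounds are below [q]. *)
Lemma Op1_dual_OSp2 : Op1 p C -> OSp2 p' (dual_cone C).
Proof.
move=> O1 f.
pose q (z : X * X) := `|f| * pcomb p `|z.1| `|z.2|.
have sq : sublinear q.
  split=> [x y|a x a0]; rewrite /q; last first.
    rewrite mulrCA ler_wpM2l// !normrZ gtr0_norm// pcomb_leZ// ltW//.
  rewrite -mulrDr ler_wpM2l//.
  apply: le_trans (pcombD p1 _ _ _ _) => //.
  by apply: pcomb_le => //; exact: ler_normD.
pose P := [set y : X * X * R | exists x a b,
  [/\ C a, C b & y = (x + a, b - x, f x)] ].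
have [||F [Fq FP]] := @mazur_orlicz _ _ q P sq.
- split.
  + by exists 0, 0, 0; split=> //; rewrite subr0 addr0 raddf0.
  + move=> _ _ [x [a [b [Ca Cb ->]]]] [y [c [d [Cc Cd ->]]]] /=.
    exists (x + y), (a + c), (b + d); split; [exact: coneD..|].
    rewrite -(raddfD f); congr (_, _, _); first exact: addrACA.
    by rewrite opprD; exact: addrACA.
  + move=> t _ t0 [x [a [b [Ca Cb ->]]]] /=.
    exists (t *: x), (t *: a), (t *: b); split; [by apply: coneZ; rewrite ?ltW..|].
    by rewrite -scalerDr -scalerBr [f (t *: x)]linearZ.
- move=> _ [x [a [b [Ca Cb ->]]]]; rewrite /q /= (le_trans (dual_le_norm _ _))//.
  (* (O.p.1) is applied to [x - b <= x <= x + a]. *)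
  rewrite ler_wpM2l// pcombC -(normrN (b - x)) opprB.
  by apply: O1; rewrite /cone_le ?subKr// addrC addKr.
have Pf x : P (x, - x, f x).
  by exists x, 0, 0; split=> //; rewrite addr0 add0r.
have P1 a : C a -> P (a, 0, 0).
  by move=> Ca; exists 0, a, 0; rewrite add0r subr0 raddf0.
have P2 b : C b -> P (0, b, 0).
  by move=> Cb; exists 0, 0, b; rewrite addr0 subr0 raddf0.
have pairE x y : F (x, y) = F (x, 0) + F (0, y).
  by rewrite -raddfD/=; congr (F (_, _)); rewrite ?addr0 ?add0r.
have gs : scalar (fun x : X => F (x, 0)).
  move=> a x y; rewrite -[RHS](linearP F).
  by congr (F (_, _)); rewrite /= scaler0 addr0.
have hs : scalar (fun x : X => F (0, x)).
  move=> a x y; rewrite -[RHS](linearP F).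
  by congr (F (_, _)); rewrite /= scaler0 addr0.
(* The separate bounds on [g] and [h] give continuity; the joint [p']-sum bound comes from
   [pcomb_dual_norm] at the end. *)
have [g [gE _]] : exists g : dualSpace X,
    (forall x, g x = F (x, 0)) /\ `|g| <= `|f|.
  apply: scalar_dual => // x; rewrite (le_trans (Fq _))// /q /= normr0.
  by rewrite ler_wpM2l// (le_trans (pcomb_le_add _ _ _))// addr0.
have [h [hE _]] : exists h : dualSpace X,
    (forall x, h x = F (0, x)) /\ `|h| <= `|f|.
  apply: scalar_dual => // x; rewrite (le_trans (Fq _))// /q /= normr0.
  by rewrite ler_wpM2l// (le_trans (pcomb_le_add _ _ _))// add0r.
exists g, h; split.
- by move=> a Ca; rewrite gE; exact: (FP _ (P1 _ Ca)).
- by move=> b Cb; rewrite hE; exact: (FP _ (P2 _ Cb)).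
- apply: val_inj; apply/funext => x /=.
  rewrite -[RHS]/((g - h) x) dual_subE gE hE.
  have fF z : f z <= F (z, 0) - F (0, z).
    rewrite -(raddfN F)/= -[_ (- _)]/(F (- 0, - z)) oppr0 -pairE.
    exact: (FP _ (Pf z)).
  apply/le_anti; rewrite fF /=.
  (* Replacing [x] by [- x] turns the one-sided bound into an equality. *)
  have := fF (- x); rewrite raddfN.
  have -> : F (- x, 0) = - F (x, 0).
    by rewrite -raddfN/=; congr (F (_, _)); rewrite oppr0.
  have -> : F (0, - x) = - F (0, x).
    by rewrite -raddfN/=; congr (F (_, _)); rewrite oppr0.
  lra.
- apply: pcomb_dual_norm => // x y; rewrite gE hE -pairE; exact: Fq.
Qed.

(** For a nearly optimal splitting [y = y1 - y2], the order gives [g y <= h y1 - f y2], and Hoelder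
    bounds the right-hand side. *)
Lemma Op2_dual_Op1 : Op2 p C -> Op1 p' (dual_cone C).
Proof.
move=> O2 f g h /dual_coneB fg /dual_coneB gh.
apply: dual_norm_le => [|x]; first exact: pcomb_ge0.
suff key y : g y <= pcomb p' `|f| `|h| * `|y|.
  by rewrite ler_norml key andbT lerNl -raddfN (le_trans (key _))// normrN.
apply/ler_addgt0Pr => e e0.
(* The added 1 keeps the divisor positive when [f] and [h] vanish. *)
have N0 : 0 < pcomb p' `|f| `|h| + 1 by rewrite ltr_wpDl// pcomb_ge0.
have [y1 [y2 [Cy1 Cy2 yE y12]]] := O2 y _ (divr_gt0 e0 N0).
have -> : g y = g y1 - g y2 by rewrite yE raddfB.
have := pcomb_hoelder p'1 (normr_ge0 f) (normr_ge0 h) (normr_ge0 y2)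
  (normr_ge0 y1).
rewrite hoelder_conjugateK (pcombC p) => hoel.
have := gh _ Cy1; have := fg _ Cy2; have := dual_le_norm h y1.
have := dual_le_norm f (- y2); rewrite raddfN normrN => a1 a2 a3 a4.
have N1 : 0 <= pcomb p' `|f| `|h| by exact: pcomb_ge0.
have Ne : pcomb p' `|f| `|h| * (e / (pcomb p' `|f| `|h| + 1)) <= e.
  by rewrite mulrCA ler_piMr ?(ltW e0)// ltW// ltr_pdivrMr// mul1r ltrDl.
have := ler_wpM2l N1 (ltW y12); rewrite mulrDr.
move: hoel a1 a2 a3 a4 Ne; clear; lra.
Qed.

(** Splitting a norming functional of [v] as [g - h], its value at [v] is at most [g w - h u], which
    Hoelder bounds. *)
Lemma dual_OSp2_Op1 : OSp2 p' (dual_cone C) -> Op1 p C.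
Proof.
move=> O2 u v w uv vw; have [f [f1 <-]] := norming_functional v.
have [g [h [g0 h0 fE gh]]] := O2 f.
have -> : f v = g v - h v.
  by rewrite fE dual_subE.
have := g0 _ vw; rewrite raddfB subr_ge0 => gvw.
have := h0 _ uv; rewrite raddfB subr_ge0 => huv.
have := pcomb_hoelder p'1 (normr_ge0 g) (normr_ge0 h) (normr_ge0 w)
  (normr_ge0 u).
rewrite hoelder_conjugateK (pcombC p) => hoel.
have := dual_le_norm g w; have := dual_le_norm h (- u).
rewrite raddfN normrN => hu gw.
have := ler_wpM2r (pcomb_ge0 p `|w| (normr_ge0 u)) (le_trans gh f1).
rewrite mul1r; move: gvw huv hoel hu gw; clear; lra.
Qed.

End Duality.

(** The form of completeness used for the series of corrections; it passes easily to closed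
    subspaces and to quotients. *)
Definition geometric_complete {R : realType} (X : normedModType R) : Prop :=
  forall (u : X^nat) (M : R), (forall n, `|u n| <= M * 2^-1 ^+ n) ->
    cvgn (series u).

(** * Recovering (O.p.2) from the dual of a complete space *)

Section DualityConverse.
Context {R : realType} {X : normedModType R}.
Variables (p : \bar R) (C : set X).
Hypotheses (p1 : (1 <= p)%E) (Ccone : is_cone C) (C0 : C 0).
Local Notation p' := (hoelder_conjugate p).

(* If the bound failed, separating [(0, 0, x)] from the cone of all
   [(a, b, b - a)] would give [f], [g], [h] with [- g <= h <= f] and
   [pcomb p' `|f| `|g| <= 1], hence [`|h| <= 1], while [h x >= `|x| + e]. *)
Lemma dual_Op1_approx (x : X) (K e : R) : Op1 p' (dual_cone C) -> 0 <= K ->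
  0 < e -> exists a b, [/\ C a, C b &
    pcomb p `|a| `|b| + K * `|x - (a - b)| < `|x| + e].
Proof.
move=> O1 K0 e0; apply: contrapT => nab.
have {}nab a b : C a -> C b ->
    `|x| + e <= pcomb p `|a| `|b| + K * `|x - (a - b)|.
  by move=> Ca Cb; rewrite leNgt; apply/negP => ab; apply: nab; exists a, b.
(* The third coordinate carries the error of the decomposition, with weight [K]. *)
pose q (z : X * X * X) := pcomb p `|z.1.1| `|z.1.2| + K * `|z.2|.
have sq : sublinear q.
  split=> [y z|a z a0]; rewrite /q.
    rewrite addrACA lerD//; last by rewrite -mulrDr ler_wpM2l// ler_normD.
    apply: le_trans (pcombD p1 _ _ _ _) => //.
    by apply: pcomb_le => //; exact: ler_normD.
  rewrite mulrDr lerD//; last by rewrite normrZ gtr0_norm// mulrCA.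
  by rewrite !normrZ gtr0_norm// pcomb_leZ// ltW.
pose L := [set z : X * X * X | exists a b, [/\ C a, C b & z = (a, b, b - a)] ].
have [||||| F [Fq Fx FL]] := @cone_separation _ _ q L (0, 0, x) (`|x| + e) sq.
- by exists 0, 0; rewrite subr0.
- move=> _ _ [a [b [Ca Cb ->]]] [c [d [Cc Cd ->]]].
  exists (a + c), (b + d); split; [exact: coneD..|].
  by congr (_, _, _); rewrite /= opprD addrACA.
- move=> t _ t0 [a [b [Ca Cb ->]]].
  exists (t *: a), (t *: b); split; [by apply: coneZ => //; exact: ltW..|].
  by rewrite -scalerBr.
- move=> _ [a [b [Ca Cb ->]]]; rewrite /q /= !add0r -opprB.
  exact: nab.
- by move=> _ [a [b [Ca Cb ->]]]; rewrite addr_ge0 ?pcomb_ge0// mulr_ge0.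
have FE a b c : F (a, b, c) = F (a, 0, 0) + F (0, b, 0) + F (0, 0, c).
  by rewrite -!raddfD/=; congr (F (_, _, _)); rewrite /= ?addr0 ?add0r.
have F0 : F (0, 0, 0) = 0 by exact: raddf0.
have s1 : scalar (fun y : X => F (y, 0, 0)).
  move=> a y z; rewrite -[RHS](linearP F).
  by congr (F (_, _, _)); rewrite /= scaler0 addr0.
have s2 : scalar (fun y : X => F (0, y, 0)).
  move=> a y z; rewrite -[RHS](linearP F).
  by congr (F (_, _, _)); rewrite /= scaler0 addr0.
have s3 : scalar (fun y : X => F (0, 0, y)).
  move=> a y z; rewrite -[RHS](linearP F).
  by congr (F (_, _, _)); rewrite /= scaler0 addr0.
have [f [fE _]] : exists f : dualSpace X,
    (forall y, f y = F (y, 0, 0)) /\ `|f| <= 1.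
  apply: scalar_dual => // y; rewrite (le_trans (Fq _))// /q /= normr0.
  by rewrite mulr0 addr0 mul1r (le_trans (pcomb_le_add _ _ _))// addr0.
have [g [gE _]] : exists g : dualSpace X,
    (forall y, g y = F (0, y, 0)) /\ `|g| <= 1.
  apply: scalar_dual => // y; rewrite (le_trans (Fq _))// /q /= normr0.
  by rewrite mulr0 addr0 mul1r (le_trans (pcomb_le_add _ _ _))// add0r.
have [h [hE _]] : exists h : dualSpace X,
    (forall y, h y = F (0, 0, y)) /\ `|h| <= K.
  apply: scalar_dual => // y; rewrite (le_trans (Fq _))// /q /= normr0.
  by rewrite gerDr (le_trans (pcomb_le_add _ _ _))// addr0.
have fg : pcomb p' `|f| `|g| <= 1.
  apply: pcomb_dual_norm => // y z; rewrite mul1r fE gE.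
  have := Fq (y, z, 0); rewrite FE /q /= normr0 mulr0 addr0.
  by rewrite F0 addr0.
(* Positivity of [F] at [(0, y, y)] gives [- g <= h], and at [(y, 0, - y)] it gives [h <= f]. *)
have hfg : `|h| <= pcomb p' `|- g| `|f|.
  apply: O1; apply/dual_coneB => y Cy.
    rewrite dual_oppE gE hE.
    have /FL : L (0, y, y) by exists 0, y; rewrite subr0.
    by rewrite FE F0 add0r; lra.
  have /FL : L (y, 0, - y) by exists y, 0; rewrite sub0r.
  rewrite FE F0 addr0 fE hE.
  rewrite (_ : F (0, 0, - y) = - F (0, 0, y)); first lra.
  by rewrite -raddfN/=; congr (F (_, _, _)); rewrite oppr0.
rewrite normrN pcombC in hfg.
have := dual_le_norm h x; rewrite hE.
have := ler_wpM2r (normr_ge0 x) (le_trans hfg fg).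
by move: Fx e0; clear; lra.
Qed.

(** The remainder [r n] is approximated by [a n - b n] up to [d n], and the new error becomes the
    next remainder. Both series converge, their sums lie in the closed cone, and the total cost
    exceeds the norm of [v] by at most [e / 2]. *)
Lemma dual_Op1_Op2 : closed C -> geometric_complete X ->
  Op1 p' (dual_cone C) -> Op2 p C.
Proof.
move=> Ccl Xc O1 v e e0.
(* The positivity premise sits under the existential so that [choice] gives a function on all
   pairs. *)
have approx (z : X * R) : exists ab : X * X, 0 < z.2 -> [/\ C ab.1, C ab.2,
    pcomb p `|ab.1| `|ab.2| <= `|z.1| + z.2 & `|z.1 - (ab.1 - ab.2)| <= z.2].
  case: z => x d /=; have [d0|] := pselect (0 < d); last by exists 0.
  have xd : 0 < `|x| + d by rewrite ltr_wpDl.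
  (* With this weight, a weighted error of at most [|x| + d] means an error of at most [d]. *)
  have [|a [b [Ca Cb ab]]] := @dual_Op1_approx x ((`|x| + d) / d) d O1 _ d0.
    by rewrite divr_ge0 ?ltW.
  exists (a, b) => _; split=> //=.
    by rewrite (le_trans _ (ltW ab))// lerDl mulr_ge0// divr_ge0// ltW.
  have : (`|x| + d) / d * `|x - (a - b)| <= `|x| + d.
    by rewrite (le_trans _ (ltW ab))// lerDr pcomb_ge0.
  by rewrite -mulrA ger_pMr// ler_pdivrMl// mulr1.
have [s sP] := choice approx.
pose d n : R := e / 8 * 2^-1 ^+ n.
have d0 n : 0 < d n by rewrite mulr_gt0 ?divr_gt0 ?exprn_gt0 ?invr_gt0.
have dS n : d n.+1 = d n / 2 by rewrite /d exprS; ring.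
pose r := fix r n := if n is m.+1 then
  r m - ((s (r m, d m)).1 - (s (r m, d m)).2) else v.
pose a n := (s (r n, d n)).1; pose b n := (s (r n, d n)).2.
have Ca n : C (a n) by have [] := sP (r n, d n) (d0 n).
have Cb n : C (b n) by have [] := sP (r n, d n) (d0 n).
have ab n : pcomb p `|a n| `|b n| <= `|r n| + d n.
  by have [] := sP (r n, d n) (d0 n).
have rS n : `|r n.+1| <= d n by have [] := sP (r n, d n) (d0 n).
(* The first term covers [r 0 = v]; for later remainders [2 * d n] is the previous tolerance. *)
have r_bound n : `|r n| <= `|v| * 2^-1 ^+ n + 2 * d n.
  case: n => [|n]; first by rewrite expr0 mulr1 lerDl mulr_ge0// ltW.
  by rewrite (le_trans (rS n))// dS ler_wpDl ?mulr_ge0// ?exprn_ge0 ?invr_ge0//; lra.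
have rE n : r n = v - (series a n - series b n).
  elim: n => [|n IH]; first by rewrite /series/= !big_geq// subrr subr0.
  rewrite [LHS]/= -/(a n) -/(b n) IH !seriesSr (opprD (series b n)).
  by rewrite (addrACA (series a n)) (opprD (series a n - _)) addrA.
(* Step [n] adds at most [2 * d n], which is [4 * d n - 4 * d n.+1]; at [n = 0] the slack [e / 2]
   equals [4 * d 0], whence the factor [e / 8] in [d]. *)
have ab_bound n : pcomb p `|series a n| `|series b n| + `|r n| <=
    `|v| + e / 2 - 4 * d n.
  elim: n => [|n IH].
    rewrite /series/= !big_geq// normr0.
    rewrite (le_trans (lerD (pcomb_le_add _ _ _) (lexx _)))// /d expr0; lra.
  rewrite !seriesSr; have := rS n; have := ab n; rewrite dS.
  have := pcombD p1 (normr_ge0 (series a n)) (normr_ge0 (series b n))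
    (normr_ge0 (a n)) (normr_ge0 (b n)).
  have := pcomb_le p1 (normr_ge0 _) (normr_ge0 _)
    (ler_normD (series a n) (a n)) (ler_normD (series b n) (b n)).
  move: IH; clear; lra.
have summable u : (forall n, `|u n| <= pcomb p `|a n| `|b n|) ->
    cvgn (series u : X^nat).
  move=> uab; apply: (Xc _ (`|v| + 3 * (e / 8))) => n.
  rewrite (le_trans (uab n))// (le_trans (ab n))//.
  by have := r_bound n; rewrite /d; clear; lra.
have acvg : cvgn (series a) by apply: summable => n; exact: le_pcombl.
have bcvg : cvgn (series b).
  by apply: summable => n; rewrite pcombC; exact: le_pcombl.
have Clim u : (forall n, C (u n)) -> cvgn (series u) -> C (limn (series u)).
  move=> Cu ucvg; apply: (closed_cvg _ Ccl _ _ ucvg); apply: nearW => n.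
  elim: n => [|n IH]; first by rewrite /series/= big_geq.
  by rewrite seriesSr; apply: coneD.
pose A := limn (series a); pose B := limn (series b).
have near_lim t : 0 < t -> exists n,
    [/\ `|A - series a n| <= t, `|B - series b n| <= t & `|r n| <= t].
  move=> t0.
  have rcvg : `|v| * 2^-1 ^+ n + 2 * d n @[n --> \oo] --> (0 : R).
    rewrite (_ : (fun n => _) = geometric (`|v| + e / 4) 2^-1); last first.
      by apply/funext => n; rewrite /d /geometric /=; field.
    by apply: cvg_geometric; rewrite ger0_norm//; lra.
  have /cvgrPdist_le Acvg : series a @ \oo --> A by exact: acvg.
  have /cvgrPdist_le Bcvg : series b @ \oo --> B by exact: bcvg.
  have /cvgrPdist_le Rcvg := rcvg.
  suff : \forall n \near \oo, [/\ `|A - series a n| <= t,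
      `|B - series b n| <= t & `|r n| <= t].
    by case=> n _ /(_ n) /(_ (leqnn _)) ?; exists n.
  near=> n; split.
  - by near: n; exact: Acvg.
  - by near: n; exact: Bcvg.
  - rewrite (le_trans (r_bound n))// -[leLHS]subr0 (le_trans (ler_norm _))//.
    rewrite distrC.
    by near: n; exact: Rcvg.
exists A, B; split; [exact: Clim|exact: Clim| |].
  apply/eqP; rewrite -subr_eq0 -normr_le0; apply/ler_addgt0Pr => t t0.
  have [n [An Bn rn]] := near_lim (t / 3) (divr_gt0 t0 (ltr0n _ 3)).
  rewrite add0r (_ : v - (A - B) = r n - ((A - series a n) - (B - series b n))).
    rewrite (le_trans (ler_normB _ _))//.
    have := ler_normB (A - series a n) (B - series b n).
    by move: An Bn rn; clear; lra.
  rewrite rE (opprD B) (addrACA A) -(opprD (series a n)) (opprB (A - B)).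
  by rewrite subrKA.
suff : pcomb p `|A| `|B| <= `|v| + e / 2 by move: e0; clear; lra.
apply/ler_addgt0Pr => t t0.
have [n [An Bn _]] := near_lim (t / 2) (divr_gt0 t0 (ltr0n _ 2)).
have := pcomb_le p1 (normr_ge0 _) (normr_ge0 _)
  (ler_normD (series a n) (A - series a n)) (ler_normD (series b n) (B - series b n)).
rewrite !subrKC => /le_trans; apply.
rewrite (le_trans (pcombD p1 _ _ _ _))//.
have := pcomb_le_add p1 (normr_ge0 (A - series a n)) (normr_ge0 (B - series b n)).
have := ab_bound n; have := d0 n; have := normr_ge0 (r n).
by move: An Bn; clear; lra.
Unshelve. all: by end_near. Qed.

End DualityConverse.

(** * The duality theorem for order smooth norms *)

Section DualityTheorem.
Context {R : realType}.
Implicit Types p : \bar R.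
Local Notation "p ^*" := (hoelder_conjugate p) : ereal_scope.

Lemma proper_coneP (X : normedModType R) (C : set X) : C 0 ->
  proper_cone C <-> forall x, C x -> C (- x) -> x = 0.
Proof.
move=> C0; split=> [Cp x Cx CNx|Cp].
  suff : (C `&` [set - y | y in C]) x by rewrite Cp.
  by split=> //; exists (- x); rewrite ?opprK.
apply/seteqP; split=> [x [Cx [y Cy yx]]|_ ->].
  by rewrite [x]Cp// -yx opprK.
by split=> //; exists 0; rewrite ?oppr0.
Qed.

Lemma OSp2_Op2 (X : normedModType R) p (C : set X) : OSp2 p C -> Op2 p C.
Proof.
move=> O v e e0; have [v1 [v2 [C1 C2 vE v12]]] := O v.
by exists v1, v2; split=> //; rewrite (le_lt_trans v12)// ltrDl.
Qed.

Lemma OSp2_generating (X : normedModType R) p (C : set X) :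
  OSp2 p C -> generating_cone C.
Proof. by move=> O v; have [v1 [v2 [? ? ? _]]] := O v; exists v1, v2. Qed.

Lemma dual_cone_closed (X : normedModType R) (C : set X) :
  closed (dual_cone C).
Proof.
rewrite [dual_cone C](_ : _ = \bigcap_(v in C)
  ((fun f : dualSpace X => f v) @^-1` [set y | 0 <= y])).
  apply: closed_bigI => v _; apply: preimage_closed; last exact: closed_ge.
  by move=> f _; exact: dual_eval_continuous.
by apply/seteqP; split.
Qed.

(** The norm conditions correspond by the preceding lemmas. Properness on each side follows from
    generation on the other: a vector or functional positive with both signs is annihilated by all
    positive elements, hence by their differences. *)
Lemma order_smooth_dual (X : normedModType R) p (C : set X) :
  (1 <= p)%E -> is_cone C -> C 0 -> closed C -> geometric_complete X ->
  order_smooth p C <->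
  order_smooth p^* (dual_cone C) /\ OSp2 p^* (dual_cone C).
Proof.
move=> p1 Cc C0 Ccl Xc; split.
  move=> [[_ _ Cg _] [opO1 opO2]].
  have OS := Op1_dual_OSp2 p1 Cc C0 opO1.
  split=> //; split; [split|split].
  - move=> a f g a0 f0 g0 v Cv.
    by rewrite dual_addE dual_scaleE addr_ge0 ?mulr_ge0 ?f0 ?g0.
  - apply/proper_coneP => // f f0 fN0; apply: val_inj; apply/funext => x /=.
    have [x1 [x2 [Cx1 Cx2 ->]]] := Cg x.
    have fC y : C y -> f y = 0.
      by move=> Cy; have := f0 y Cy; have := fN0 y Cy; rewrite dual_oppE; lra.
    by transitivity (f x1 - f x2); [exact: raddfB|rewrite !fC// subrr].
  - exact: OSp2_generating OS.
  - exact: dual_cone_closed.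
  - exact: Op2_dual_Op1 opO2.
  - exact: OSp2_Op2.
move=> [[[_ _ dg _] [dO1 _]] OS].
have O2 := dual_Op1_Op2 p1 Cc C0 Ccl Xc dO1.
split; split=> //.
- apply/proper_coneP => // x Cx CNx; apply/eqP; rewrite -normr_eq0; apply/eqP.
  have [f [_ <-]] := norming_functional x.
  have [g [h [g0 h0 ->]]] := dg f.
  have h0x (k : dualSpace X) : dual_cone C k -> k x = 0.
    by move=> k0; have := k0 x Cx; have := k0 _ CNx; rewrite raddfN; lra.
  by rewrite dual_subE !h0x// subrr.
- move=> v; have [v1 [v2 [? ? ? _]]] := O2 v 1 ltr01; by exists v1, v2.
- exact: dual_OSp2_Op1.
Qed.

End DualityTheorem.

(** * Invariance under isometric order isomorphisms *)

Section IsometricTransfer.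
Context {R : realType}.
Implicit Types p : \bar R.

Lemma order_smooth_pullback (X Y : normedModType R) (T : {linear X -> Y}) (S : Y -> X) (C : set X)
  (D : set Y) p : cancel T S -> cancel S T -> (forall x, `|T x| = `|x|) ->
  (forall x, C x <-> D (T x)) ->
  (order_smooth p D -> order_smooth p C) /\ (OSp2 p D -> OSp2 p C).
Proof.
move=> TK SK Tn CD; have Sn y : `|S y| = `|y| by rewrite -Tn SK.
have SC y : D y -> C (S y) by move=> Dy; apply/CD; rewrite SK.
have SB y z : S (y - z) = S y - S z.
  by apply: (can_inj TK); rewrite linearB !SK.
split=> [[[Dc Dp Dg Dcl] [opO1 opO2]]|OS v]; last first.
  have [v1 [v2 [D1 D2 vE v12]]] := OS (T v).
  exists (S v1), (S v2); split; [exact: SC|exact: SC| |by rewrite !Sn -(Tn v)].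
  by rewrite -SB -vE TK.
have D0 : D 0.
  have : [set 0 : Y] 0 by [].
  by rewrite -Dp => -[].
have C0 : C 0 by apply/CD; rewrite linear0.
split; [split|split].
- by move=> a x y a0 /CD Dx /CD Dy; apply/CD; rewrite linearP; exact: Dc.
- apply/proper_coneP => // x /CD Dx /CD; rewrite linearN => DNx.
  by rewrite -[x]TK ((proper_coneP D0).1 Dp _ Dx DNx) -(linear0 T) TK.
- move=> v; have [v1 [v2 [D1 D2 vE]]] := Dg (T v).
  by exists (S v1), (S v2); split; [exact: SC|exact: SC|rewrite -SB -vE TK].
- rewrite (_ : C = T @^-1` D); last by apply/seteqP; split=> x /CD.
  apply: preimage_closed => // x _; apply: bounded_linear_continuous.
  apply/linear_boundedP; exists 1; split=> [|r r1 z]; first exact: num_real.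
  by rewrite Tn ler_peMl// ltW.
- move=> u v w /CD uv /CD vw; rewrite -!Tn; apply: opO1.
    by rewrite /cone_le -linearB.
  by rewrite /cone_le -linearB.
- move=> v e e0; have [v1 [v2 [D1 D2 vE v12]]] := opO2 (T v) e e0.
  exists (S v1), (S v2); split; [exact: SC|exact: SC| |by rewrite !Sn -(Tn v)].
  by rewrite -SB -vE TK.
Qed.

(** A surjective linear isometry has a linear isometric inverse, so conditions can be pulled back
    along both maps. *)
Lemma order_smooth_isometry (X Y : normedModType R) (T : X -> Y) (C : set X)
  (D : set Y) p : linear T -> (forall x, `|T x| = `|x|) ->
  (forall y, exists x, T x = y) -> (forall x, C x <-> D (T x)) ->
  (order_smooth p C <-> order_smooth p D) /\ (OSp2 p C <-> OSp2 p D).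
Proof.
move=> Tlin Tn Tsurj CD.
pose L : {linear X -> Y} := HB.pack T (GRing.isLinear.Build R X Y *:%R T Tlin).
have TB : {morph T : x y / x - y} := raddfB L.
have [S SK] := choice Tsurj.
have Tinj x y : T x = T y -> x = y.
  move=> xy; apply/eqP; rewrite -subr_eq0 -normr_eq0 -Tn TB xy.
  by rewrite subrr normr0.
have TK : cancel T S by move=> x; apply: Tinj; rewrite SK.
have Slin : linear S by move=> a x y; apply: Tinj; rewrite Tlin !SK.
pose M : {linear Y -> X} := HB.pack S (GRing.isLinear.Build R Y X *:%R S Slin).
have Sn y : `|S y| = `|y| by rewrite -Tn SK.
have DC y : D y <-> C (S y) by rewrite -{1}(SK y); split=> /CD.
have [cd1 cd2] := @order_smooth_pullback X Y L S C D p TK SK Tn CD.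
have [dc1 dc2] := @order_smooth_pullback Y X M T D C p SK TK Sn DC.
by split; split.
Qed.

End IsometricTransfer.

(** * Subspaces and quotients *)

Section Completeness.
Context {R : realType} {V : completeNormedModType R} (W : closedSubspace V).

Lemma complete_geometric : geometric_complete V.
Proof.
move=> u M uM; apply: normed_cvg; apply: (series_le_cvg _ _ uM) => //.
  by move=> n; rewrite (le_trans _ (uM n)).
by apply: is_cvg_geometric_series; rewrite ger0_norm ?invr_ge0// invf_lt1// ltr1n.
Qed.

Lemma csub_geometric : geometric_complete (csubType W).
Proof.
move=> u M uM; have vcvg := @complete_geometric (val \o u) M uM.
have sE n : series (val \o u) n = val (series u n).
  elim: n => [|n IH]; first by rewrite /series/= !big_geq// raddf0.
  by rewrite !seriesSr IH raddfD.
have lW : csub_set W (limn (series (val \o u))).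
  apply: (closed_cvg _ (@csub_closed _ _ W) _ _ vcvg); apply: nearW => n.
  by rewrite sE; apply/csub_predE; exact: valP.
pose l : csubType W := CSubType ((csub_predE _ _).2 lW).
apply/cvg_ex; exists l; apply/cvgrPdist_le => e e0.
have /cvgrPdist_le/(_ e e0) : series (val \o u) @ \oo --> val l by exact: vcvg.
apply: filterS => n; rewrite sE csub_normE raddfB; exact.
Qed.

Lemma quot_map_le_norm (x : V) : `|quot_map W x| <= `|x|.
Proof. exact: quot_norm_le. Qed.

(** Each term lifts to a representative whose norm grows by at most [2^-1 ^+ n], so the lifted
    series is still geometrically bounded, with [M + 1]; the class of its sum is the limit. *)
Lemma quot_geometric : geometric_complete (quotSpace W).
Proof.
move=> u M uM; have lift n : exists x, quot_map W x = u n /\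
    `|x| <= (M + 1) * 2^-1 ^+ n.
  have e0 : 0 < (2^-1 : R) ^+ n by rewrite exprn_gt0// invr_gt0.
  have [x xu xe] := quot_norm_lt (u n) e0; exists x; split=> //.
  rewrite (le_trans (ltW xe))// mulrDl mul1r lerD//; exact: uM.
have [v vP] := choice lift.
have vcvg := @complete_geometric v (M + 1) (fun n => (vP n).2).
apply/cvg_ex; exists (quot_map W (limn (series v))); apply/cvgrPdist_le => e e0.
have /cvgrPdist_le/(_ e e0) : series v @ \oo --> limn (series v) by exact: vcvg.
apply: filterS => n; apply: le_trans.
have -> : series u n = quot_map W (series v n).
  elim: n => [|n IH]; first by rewrite /series/= !big_geq// quot_map0.
  by rewrite !seriesSr IH quot_mapD (vP n).1.
rewrite (_ : _ - _ = quot_map W (limn (series v) - series v n)) ?quot_map_le_norm//.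
by rewrite /quot_map raddfB.
Qed.

End Completeness.

(** * The dual of a quotient as an annihilator *)

Section QuotientDual.
Context {R : realType} {V : normedModType R} (W : closedSubspace V).
Variable C : set V.
Hypotheses (Ccone : is_cone C) (C0 : C 0).
Local Notation Q := (quotSpace W).

Lemma closure_normP (X : normedModType R) (S : set X) (x : X) :
  closure S x <-> forall e, 0 < e -> exists2 s, S s & `|x - s| < e.
Proof.
split=> [Sx e e0|Sx U /nbhs_normP[e /= e0 eU]].
  by have [s [Ss xs]] := Sx _ (nbhsx_ballx x _ e0); exists s => //; move: xs; rewrite -ball_normE.
by have [s Ss xs] := Sx _ e0; exists s; split=> //; exact: eU.
Qed.

Lemma quot_cone_is_cone : is_cone (quot_cone W C).
Proof.
move=> a q r a0 /closure_normP Cq /closure_normP Cr; apply/closure_normP => e e0.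
have a1 : 0 < a + 1 by rewrite ltr_wpDl.
have e2 : 0 < e / 2 by rewrite divr_gt0.
have [_ [x Cx <-] qx] := Cq _ (divr_gt0 e2 a1).
have [_ [y Cy <-] ry] := Cr _ e2.
exists (quot_map W (a *: x + y)); first by exists (a *: x + y) => //; exact: Ccone.
rewrite quot_mapD quot_mapZ -[quot_scale _ _]/(a *: quot_map W x) opprD addrACA.
rewrite -scalerBr [ltRHS]splitr (le_lt_trans (ler_normD _ _))// ler_ltD//.
rewrite normrZ ger0_norm// (le_trans (ler_wpM2l a0 (ltW qx)))//.
by rewrite mulrCA ler_piMr ?(ltW e2)// ltW// ltr_pdivrMr// mul1r ltrDl.
Qed.

Lemma quot_cone0 : quot_cone W C 0.
Proof. by apply: subset_closure; exists 0; rewrite ?quot_map0. Qed.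

Lemma quot_norm_ler (q : Q) (k M : R) : 0 <= M ->
  (forall x, quot_map W x = q -> k <= M * `|x|) -> k <= M * `|q|.
Proof.
move=> M0 kM; apply/ler_addgt0Pr => e e0.
have M1 : 0 < M + 1 by rewrite ltr_wpDl.
have [x xq xe] := quot_norm_lt q (divr_gt0 e0 M1).
rewrite (le_trans (kM _ xq))// (le_trans (ler_wpM2l M0 (ltW xe)))//.
rewrite mulrDr lerD2l mulrCA ler_piMr ?(ltW e0)// ltW// ltr_pdivrMr//.
by rewrite mul1r ltrDl.
Qed.

Lemma quot_map_linear : linear (quot_map W).
Proof. by move=> a x y; rewrite quot_mapD quot_mapZ. Qed.

Lemma quot_map_continuous : continuous (quot_map W).
Proof.
pose L : {linear V -> Q} :=
  HB.pack (quot_map W) (GRing.isLinear.Build R V Q *:%R _ quot_map_linear).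
apply: (@bounded_linear_continuous R V Q L); apply/linear_boundedP.
exists 1; split=> [|r r1 z]; first exact: num_real.
by rewrite (le_trans (quot_norm_le W z))// ler_peMl// ltW.
Qed.

Lemma pullback_dual (f : dualSpace Q) : (f \o quot_map W : V -> R) \in dual_pred V.
Proof.
apply/asboolP; split=> [a x y|x].
  by rewrite /= quot_map_linear linearP.
by apply: continuous_comp; [exact: quot_map_continuous|exact: dual_continuous].
Qed.

Lemma pullback_annihilator (f : dualSpace Q) :
  DualSpace (pullback_dual f) \in csub_pred (annihilator W).
Proof.
apply/csub_predE => w Ww /=.
suff -> : quot_map W w = 0 by rewrite raddf0.
by rewrite -quot_map0; apply/quot_mapP; rewrite subr0.
Qed.

(** The adjoint of the quotient map, which identifies the dual of [V/W] with [W^perp]. *)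
Definition quot_pullback (f : dualSpace Q) : csubType (annihilator W) :=
  CSubType (pullback_annihilator f).

Lemma quot_pullback_linear : linear quot_pullback.
Proof. by move=> a f g; apply: val_inj; apply: val_inj; apply/funext. Qed.

Lemma quot_pullback_norm (f : dualSpace Q) : `|quot_pullback f| = `|f|.
Proof.
apply/le_anti/andP; split.
  apply: dual_norm_le => // x /=; rewrite (le_trans (dual_norm_ge f _))//.
  by rewrite ler_wpM2l ?dual_norm_ge0// quot_norm_le.
apply: dual_norm_le => // q; apply: quot_norm_ler => // x <-.
exact: (dual_norm_ge (val (quot_pullback f)) x).
Qed.

Lemma quot_pullback_surj (g : csubType (annihilator W)) :
  exists f, quot_pullback f = g.
Proof.
(* Since [g] vanishes on [W], its value is the same at every representative. *)
pose h q := val g (repr (q : Q)).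
have hE x : h (quot_map W x) = val g x.
  apply/eqP; rewrite -subr_eq0 -(raddfB (val g)); apply/eqP.
  have /csub_predE : val g \in csub_pred (annihilator W) by exact: valP.
  by apply; apply/quot_mapP; rewrite /quot_map reprK.
have hlin : scalar h.
  move=> a q r; have [x <-] := quot_map_surj q; have [y <-] := quot_map_surj r.
  by rewrite -quot_map_linear !hE linearP.
have [|q|f [fE _]] := @scalar_dual _ _ h `|g| hlin.
- by [].
- apply: quot_norm_ler => // x <-; rewrite hE; exact: dual_le_norm.
exists f; apply: val_inj; apply: val_inj; apply/funext => x /=.
by rewrite -[LHS]/(f (quot_map W x)) fE hE.
Qed.

(** Positivity on the image of [C] extends to its norm closure by continuity of [f]. *)
Lemma quot_pullback_cone (f : dualSpace Q) : dual_cone (quot_cone W C) f <->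
  sub_cone (annihilator W) (dual_cone C) (quot_pullback f).
Proof.
split=> f0 x Cx; first by apply: f0; apply: subset_closure; exists x.
have : closed (f @^-1` [set y | 0 <= y]).
  apply: preimage_closed => [y _|]; [exact: dual_continuous|exact: closed_ge].
apply; apply: closure_subset Cx => _ [y Cy <-]; exact: f0.
Qed.

End QuotientDual.

(** * The dual of a subspace as a quotient of the dual *)

Section SubspaceDual.
Context {R : realType} {V : normedModType R} (W : closedSubspace V).
Variable C : set V.
Hypotheses (Ccone : is_cone C) (C0 : C 0) (Ccl : closed C).
Local Notation D := (quotSpace (annihilator W)).

(** Norm-preserving extension: [P] is the graph of [f], and lower bounds on a linear subspace are
    equalities. *)
Lemma dual_restr_surj (f : dualSpace (csubType W)) :
  exists g : dualSpace V, dual_restr W g = f /\ `|g| <= `|f|.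
Proof.
pose P := [set y : V * R | exists w : csubType W, y = (val w, f w)].
have [||F [Fq FP]] :=
  @mazur_orlicz _ _ _ P (norm_scale_sublinear (normr_ge0 f)).
- split.
  + by exists 0; rewrite raddf0 raddf0.
  + move=> _ _ [w ->] [z ->]; exists (w + z) => /=.
    by congr (_, _); rewrite raddfD.
  + move=> a _ a0 [w ->]; exists (a *: w) => /=.
    by congr (_, _); rewrite linearZ.
- by move=> _ [w ->]; exact: dual_le_norm.
have [g [gF gf]] := scalar_dual (@linearP _ _ _ _ F) (normr_ge0 f) Fq.
exists g; split=> //; apply: val_inj; apply/funext => w /=.
have fF z : f z <= F (val z) by apply: (FP (val z, f z)); exists z.
rewrite -[LHS]/(g (val w)) gF; apply/le_anti; rewrite fF andbT.
by have := fF (- w); rewrite !raddfN lerN2.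
Qed.

Lemma quot_dual_restr_linear : linear (@quot_dual_restr R V W).
Proof.
move=> a q r; have [f <-] := quot_map_surj q; have [g <-] := quot_map_surj r.
rewrite -[a *: _]/(quot_scale a (quot_map _ f)) -quot_mapZ -quot_mapD.
by rewrite !quot_dual_restrE; apply: val_inj.
Qed.

(** Restriction does not increase norms, and a norm-preserving extension is a representative of the
    class attaining the other bound. *)
Lemma quot_dual_restr_norm (q : D) : `|quot_dual_restr q| = `|q|.
Proof.
apply/le_anti/andP; split.
  rewrite -[leRHS]mul1r; apply: quot_norm_ler => // f <-; rewrite mul1r.
  rewrite quot_dual_restrE; apply: dual_norm_le => // w.
  exact: (dual_norm_ge f (val w)).
have [g [gq gle]] := dual_restr_surj (quot_dual_restr q).
suff -> : q = quot_map (annihilator W) g.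
  by rewrite (le_trans (quot_norm_le _ _))// quot_dual_restrE gq.
have [f fq] := quot_map_surj q; rewrite -fq; apply/quot_mapP => w Ww.
move: gq; rewrite -fq quot_dual_restrE => gf.
have := congr1 (fun h : dualSpace (csubType W) =>
  h (CSubType ((csub_predE W w).2 Ww))) gf.
rewrite /= => gfw; rewrite -[LHS]/((f - g) w) dual_subE.
by apply/eqP; rewrite subr_eq0; apply/eqP.
Qed.

Lemma quot_dual_restr_surj (f : dualSpace (csubType W)) :
  exists q : D, quot_dual_restr q = f.
Proof.
have [g [gf _]] := dual_restr_surj f.
by exists (quot_map _ g); rewrite quot_dual_restrE.
Qed.

(** If [v] had distance at least [d > 0] from [C], separating [- v] from [C] would give a positive
    functional with value at most [- d] at [v]. *)
Lemma cone_bipolar (v : V) : (forall g, dual_cone C g -> 0 <= g v) -> C v.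
Proof.
move=> gv; apply: Ccl; apply/closure_normP => d d0; apply: contrapT => far.
have {}far c : C c -> d <= 1 * `|- v + c|.
  move=> Cc; rewrite mul1r addrC distrC leNgt; apply/negP => vc.
  by apply: far; exists c.
have [||| F [Fq Fv FC]] :=
  @cone_separation _ _ _ C (- v) d (norm_scale_sublinear ler01) C0 _ _ far.
- exact: coneD.
- by move=> a x a0; apply: coneZ => //; exact: ltW.
- by move=> c _; rewrite mulr_ge0.
have [f [fF _]] := scalar_dual (@linearP _ _ _ _ F) ler01 Fq.
have : 0 <= f v by apply: gv => c Cc; rewrite fF FC.
by move: Fv d0; rewrite fF raddfN; lra.
Qed.

(* Finite-dimensional core of the weak* density: a separating functional on
   [R^s] is a linear combination of evaluations, i.e. a vector of [W]. *)
Lemma dual_cone_approx (f : dualSpace (csubType W)) (s : seq (csubType W))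
  (e : R) : dual_cone (sub_cone W C) f -> 0 < e ->
  exists2 g, dual_cone C g & forall w, w \in s -> `|f w - g (val w)| < e.
Proof.
move=> f0 e0; apply: contrapT => nog.
pose n := size s; pose w (j : 'I_n) := s`_j.
(* The [l^1] norm dominates every coordinate, so a small [q] makes all the evaluations close at
   once. *)
pose q (y : 'rV[R]_n) := \sum_j `|y 0 j|.
pose ev (g : dualSpace V) : 'rV[R]_n := \row_j g (val (w j)).
pose y0 : 'rV[R]_n := \row_j f (w j).
have sq : sublinear q.
  split=> [x y|a x a0]; rewrite /q.
    by rewrite -big_split/= ler_sum// => j _; rewrite mxE ler_normD.
  by rewrite mulr_sumr ler_sum// => j _; rewrite mxE normrM gtr0_norm.
pose K := [set y | exists2 g, dual_cone C g & y = - ev g].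
have far k : K k -> e <= q (y0 + k).
  move=> [g g0 ->]; rewrite leNgt; apply/negP => qe; apply: nog.
  exists g => // z /(nthP 0)[j js <-]; apply: le_lt_trans qe.
  rewrite /q (bigD1 (Ordinal js))//= !mxE lerDl.
  by apply: sumr_ge0.
have [||||F [Fq Fy FK]] := @cone_separation _ _ q K y0 e sq _ _ _ far.
- exists 0; first by move=> v _.
  by apply/rowP => j; rewrite !mxE oppr0.
- move=> _ _ [g g0 ->] [h h0 ->]; exists (g + h).
    by move=> v Cv; rewrite dual_addE addr_ge0 ?g0 ?h0.
  by apply/rowP => j; rewrite !mxE dual_addE opprD.
- move=> a _ a0 [g g0 ->]; exists (a *: g).
    by move=> v Cv; rewrite dual_scaleE mulr_ge0 ?g0 ?ltW.
  by apply/rowP => j; rewrite !mxE dual_scaleE mulrN.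
- by move=> k _; apply: sumr_ge0.
pose z : csubType W := \sum_j F (delta_mx 0 j) *: w j.
have FE y : F y = \sum_j y 0 j * F (delta_mx 0 j).
  by rewrite {1}[y]row_sum_delta raddf_sum; apply: eq_bigr => j _; exact: (scalarZ F).
have Fev g : F (ev g) = g (val z).
  rewrite FE /z !raddf_sum; apply: eq_bigr => j _.
  by rewrite mxE mulrC; exact/esym/(scalarZ (dual_restr W g)).
(* [F] is nonnegative at [- ev g], that is, every positive [g] is nonnegative at [- z]. The bipolar
   theorem puts [- z] in the cone, so [f z <= 0], against [f z = F y0 >= e]. *)
have Cz : C (- val z).
  apply: cone_bipolar => g g0.
  have -> : g (- val z) = F (- ev g).
    transitivity (- F (ev g)); last exact/esym/(raddfN F).
    by rewrite Fev; exact: raddfN.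
  by apply: FK; exists g.
have : 0 <= f (- z) by apply: f0; exact: Cz.
have Fyz : F y0 = f z.
  rewrite FE /z raddf_sum; apply: eq_bigr => j _.
  by rewrite mxE mulrC; exact/esym/(scalarZ f).
have -> : f (- z) = - F y0 by rewrite Fyz; exact: raddfN.
by move: Fy e0; lra.
Qed.

(** Evaluations at points of [W] are weak* continuous, so positivity survives the closure.
    Conversely, [dual_cone_approx] meets every weak* neighbourhood, which constrains finitely many
    evaluations. *)
Lemma quot_dual_coneE (q : D) : quot_dual_cone W C q <->
  dual_cone (sub_cone W C) (quot_dual_restr q).
Proof.
split=> [Cq w Cw|f0 U].
  pose ew (r : weak_star_quot W) : R := quot_dual_restr r w.
  have c1 : continuous
      (@quot_dual_restr R V W : weak_star_quot W -> weak_star (csubType W)).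
    exact: initial_continuous.
  have c2 : continuous (@dual_val R (csubType W) :
      weak_star (csubType W) -> {ptws csubType W -> R}).
    exact: initial_continuous.
  have c3 : continuous (fun h : {ptws csubType W -> R} => h w).
    exact: (@proj_continuous (csubType W) (fun=> R) w).
  have ewc : continuous ew.
    move=> r; exact: (continuous_comp (c1 r) (continuous_comp (c2 _) (c3 _))).
  have : closed (ew @^-1` [set y | 0 <= y]).
    by apply: preimage_closed => [y _|]; [exact: ewc|exact: closed_ge].
  apply; apply: closure_subset Cq => _ [g g0 <-].
  change (0 <= quot_dual_restr (quot_map (annihilator W) g) w).
  by rewrite quot_dual_restrE; exact: g0.
(* Both topologies are initial: [B] is a preimage of [B1] along [quot_dual_restr], and [B1] of a
   pointwise open [B2]. *)
rewrite nbhsE => -[B [[B1 B1o B1E] Bq] BU].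
case: B1o => B2 B2o B2E.
set f := quot_dual_restr q in f0.
have B2f : B2 (dual_val f).
  by move: Bq; rewrite -B1E -B2E.
(* The filter generated by finite-coordinate boxes around [f]. Its pointwise convergence to [f]
   extracts from [B2] a finite list [s] and a radius [e]. *)
pose F : set_system (csubType W -> R) := [set P | exists (s : seq (csubType W)) e,
  0 < e /\ forall h, (forall w, w \in s -> `|f w - h w| < e) -> P h].
have FF : Filter F.
  split.
  - by exists [::], 1.
  - move=> P P' [s [e [e0 sP]]] [s' [e' [e'0 sP']]].
    exists (s ++ s'), (Num.min e e'); split; first by rewrite lt_min e0.
    move=> h hs; split; [apply: sP|apply: sP'] => w ws.
      have := hs w; rewrite mem_cat ws => /(_ isT).
      by rewrite lt_min => /andP[].
    have := hs w; rewrite mem_cat ws orbT => /(_ isT).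
    by rewrite lt_min => /andP[].
  - move=> P P' PP' [s [e [e0 sP]]]; exists s, e; split=> // h /sP; exact: PP'.
have Ff : {ptws, F --> (dual_val f : csubType W -> R)}.
  apply/pointwise_cvgP => w; apply/cvgrPdist_lt => e e0.
  by exists [:: w], e; split=> // h /(_ w (mem_head _ _)).
have [s [e [e0 sB]]] : F B2.
  by apply: Ff; apply: open_nbhs_nbhs.
have [g g0 gf] := dual_cone_approx s f0 e0.
exists (quot_map (annihilator W) g); split; first by exists g.
have gB : B2 (dual_val (quot_dual_restr (quot_map (annihilator W) g))).
  by apply: sB => w ws; rewrite quot_dual_restrE; exact: gf.
by apply: BU; rewrite -B1E -B2E.
Qed.

End SubspaceDual.

Theorem theorem3p2 (R : realType) (p : \bar R) (V : completeNormedModType R)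
    (C : set V) (W : closedSubspace V) :
  (1 <= p)%E ->
  order_smooth p C ->
  let p' := hoelder_conjugate p in
  (order_smooth p (sub_cone W C) <->
   order_smooth p' (quot_dual_cone W C) /\ OSp2 p' (quot_dual_cone W C)) /\
  (order_smooth p (quot_cone W C) <->
   order_smooth p' (sub_cone (annihilator W) (dual_cone C)) /\
   OSp2 p' (sub_cone (annihilator W) (dual_cone C))).
Proof.
move=> p1 [[Cc Cp _ Ccl] _] p'.
have C0 : C 0 by have : [set (0 : V)] 0 by []; rewrite -Cp => -[].
split.
  (* For (i), the quotient of the dual is replaced by the dual of [W] with the dual cone. *)
  have [-> ->] := order_smooth_isometry p' (@quot_dual_restr_linear _ _ W)
    (@quot_dual_restr_norm _ _ W) (@quot_dual_restr_surj _ _ W)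
    (quot_dual_coneE Cc C0 Ccl).
  apply: order_smooth_dual => //.
  - by move=> a x y a0 Cx Cy; exact: (Cc a (val x) (val y)).
  - by apply: preimage_closed => // x _; exact: csub_val_continuous.
  - exact: csub_geometric.
(* For (ii), the annihilator is replaced by the dual of [V/W] with the dual cone. *)
have [<- <-] := order_smooth_isometry p' (@quot_pullback_linear _ _ W)
  (@quot_pullback_norm _ _ W) (@quot_pullback_surj _ _ W)
  (@quot_pullback_cone _ _ W C).
apply: order_smooth_dual => //.
- exact: quot_cone_is_cone.
- exact: quot_cone0.
- exact: closed_closure.
- exact: quot_geometric.
Qed.
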